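(* Let $\alpha\in(0,1)$, $\lambda\in\mathbb{R}$, $n\in\mathbb{N}$, and let $f$ be any function such that ${}^{TR}\mathcal{D}^{k\alpha,\lambda}_{\Psi}f$ exists and is continuous for all $k=0,1,2,\ldots,n+1$. Then, for all $t\in[0,b]$, we have $$f(t)=e^{-\lambda(\Psi(t)-\Psi(0))}\Bigg\{\sum_{k=0}^{n}\frac{(\Psi(t)-\Psi(0))^{(k+1)\alpha-1}}{\Gamma((k+1)\alpha)}\left[\mathcal{I}^{1-\alpha}_{\Psi}\left(e^{\lambda(\Psi(t)-\Psi(0))}\left({}^{TR}\mathcal{D}^{\alpha,\lambda}_{\Psi}\right)^{k}f(t)\right)\right]_{t=0}+(\Psi(t)-\Psi(0))^{(n+1)\alpha}E_{1,(n+1)\alpha+1}\big(\lambda(\Psi(t)-\Psi(0))\big)\cdot\left({}^{TR}\mathcal{D}^{\alpha,\lambda}_{\Psi}\right)^{n+1}f(c)\Bigg\}$$ for some $c\in(0,t)$.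
   Context: Throughout, $b>0$ is fixed and $\Psi$ is a smooth monotonic real function on $[0,b]$ with $\Psi'>0$ almost everywhere. For $\beta>0$ and $\lambda\in\mathbb{R}$, the $\Psi$-tempered fractional integral is $${}^{T}\mathcal{I}^{\beta,\lambda}_{\Psi}y(t)=\frac{1}{\Gamma(\beta)}\int_0^t\Psi'(s)(\Psi(t)-\Psi(s))^{\beta-1}e^{-\lambda(\Psi(t)-\Psi(s))}y(s)\,\mathrm{d}s,$$ and the $\Psi$-Riemann--Liouville integral $\mathcal{I}^{\beta}_{\Psi}$ is the case $\lambda=0$. For $m\in\mathbb{N}$ and $\beta\in(m-1,m)$, the $\Psi$-tempered fractional derivative of Riemann--Liouville type of order $\beta$ is $${}^{TR}\mathcal{D}^{\beta,\lambda}_{\Psi}y(t)=\left(\frac{1}{\Psi'(t)}\frac{\mathrm{d}}{\mathrm{d}t}+\lambda\right)^{m}{}^{T}\mathcal{I}^{m-\beta,\lambda}_{\Psi}y(t).$$ For integer order $m$ the derivative is $\left(\frac{1}{\Psi'(t)}\frac{\mathrm{d}}{\mathrm{d}t}+\lambda\right)^{m}y(t)$, and for order $0$ it is $y$ itself. Thus ${}^{TR}\mathcal{D}^{k\alpha,\lambda}_{\Psi}$ denotes the single derivative of order $k\alpha$, whereas $\left({}^{TR}\mathcal{D}^{\alpha,\lambda}_{\Psi}\right)^{k}$ denotes the $k$-fold composition of ${}^{TR}\mathcal{D}^{\alpha,\lambda}_{\Psi}$ with itself (the identity for $k=0$). $[\,\cdot\,]_{t=0}$ denotes the value at $t=0$.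 $E_{p,q}(z)=\sum_{j=0}^\infty \frac{z^j}{\Gamma(pj+q)}$ is the two-parameter Mittag-Leffler function.
   Formalization: At t=0 the interval (0,t) is empty, so c in (0,t) is claimed only for t>0 and c=0 is taken at t=0, where undefined negative powers of 0 count as 0; where Psi'=0 the operator (1/Psi')d/dt is read as a limit of y'/Psi' along points with Psi' nonzero. *)

(* Defs.v *)
From HB Require Import structures.
From mathcomp Require Import all_boot all_order all_algebra.
From mathcomp Require Import all_classical all_reals all_analysis.

Set Implicit Arguments.
Unset Strict Implicit.
Unset Printing Implicit Defensive.

Import Order.TTheory GRing.Theory Num.Theory.
Import numFieldNormedType.Exports.

Local Open Scope classical_set_scope.
Local Open Scope ring_scope.

(* Euler's integral: this is the Gamma function for 0 < a only. *)
Definition Gamma (R : realType) (a : R) : R :=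
  \int[lebesgue_measure]_(x in `]0, +oo[) (x `^ (a - 1) * expR (- x)).

(* Meaningful for 0 < p and 0 < q, where Gamma only sees positive arguments. *)
Definition mittag_leffler (R : realType) (p q z : R) : R :=
  limn (series (fun j : nat => z ^+ j / Gamma (p * j%:R + q))).

(* Functions on [0, b] are represented by functions R -> R of which only the
   values on [0, b] are used.  In particular d/dt is the derivative within
   [0, b], which is one-sided at the endpoints 0 and b. *)
Section Derivative.
Context {R : realType}.
Implicit Types (b t : R) (y : R -> R).

Definition wquot b y t : set_system R :=
  (y s - y t) / (s - t) @[s --> within `[0, b] t^'].

Definition wderivable b y t : Prop := cvg (wquot b y t).

Definition wderive b y t : R := lim (wquot b y t).

Definition smooth_on b y : Prop :=
  forall (k : nat) t, 0 <= t <= b -> wderivable b (iter k (wderive b) y) t.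

End Derivative.

Section TemperedCalculus.
Context {R : realType}.
Variables (b : R) (Psi : R -> R).
Implicit Types (beta lam t : R) (y : R -> R) (m : nat).

(* Psi' is only assumed to be positive almost everywhere, so the quotient
   y'(t) / Psi'(t) may be undefined on a null set.  There y still has to be
   differentiable, and the value of (1/Psi') d/dt y is the limit of that
   quotient along the points where Psi' does not vanish. *)
Definition noncritical : set R :=
  [set t | 0 <= t <= b /\ wderive b Psi t != 0].

Definition psi_quot y t : R := (wderive b Psi t)^-1 * wderive b y t.

Definition psi_derivable y : Prop :=
  forall t, 0 <= t <= b ->
    wderivable b y t /\
    (wderive b Psi t = 0 ->
      cvg (psi_quot y s @[s --> within noncritical (nbhs t)])).

Definition psi_derive y t : R :=
  if wderive b Psi t != 0 then psi_quot y t
  else lim (psi_quot y s @[s --> within noncritical (nbhs t)]).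

Definition tempered_op lam y t : R := psi_derive y t + lam * y t.

Definition tempered_op_exists lam m y : Prop :=
  forall j, (j < m)%N -> psi_derivable (iter j (tempered_op lam) y).

Definition tempered_integrand beta lam y t s : R :=
  wderive b Psi s * (Psi t - Psi s) `^ (beta - 1)
  * expR (- lam * (Psi t - Psi s)) * y s.

Definition tempered_integral beta lam y t : R :=
  (Gamma beta)^-1 *
  \int[lebesgue_measure]_(s in `[0, t]) tempered_integrand beta lam y t s.

Definition tempered_integral_exists beta lam y : Prop :=
  forall t, 0 <= t <= b ->
    (@lebesgue_measure R).-integrable `[0, t]
      (EFin \o tempered_integrand beta lam y t).

Definition RL_integral beta y t : R := tempered_integral beta 0 y t.

(* For 0 <= beta.  When beta is not an integer, the m such that
   m - 1 < beta < m is (Num.truncn beta).+1; when beta is an integer, it is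
   Num.truncn beta (so that order 0 gives y). *)
Definition TRD beta lam y : R -> R :=
  if beta \is a Num.nat then iter (Num.truncn beta) (tempered_op lam) y
  else let m := (Num.truncn beta).+1 in
       iter m (tempered_op lam) (tempered_integral (m%:R - beta) lam y).

Definition TRD_exists beta lam y : Prop :=
  if beta \is a Num.nat then tempered_op_exists lam (Num.truncn beta) y
  else let m := (Num.truncn beta).+1 in
       tempered_integral_exists (m%:R - beta) lam y /\
       tempered_op_exists lam m (tempered_integral (m%:R - beta) lam y).

End TemperedCalculus.

(* Main.v *)
Require Import Defs.
From HB Require Import structures.
From mathcomp Require Import all_boot all_order all_algebra.
From mathcomp Require Import all_classical all_reals all_analysis.
From mathcomp Require Import measurable_realfun ring lra.

Set Implicit Arguments.
Unset Strict Implicit.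
Unset Printing Implicit Defensive.

Import Order.TTheory GRing.Theory Num.Theory.
Import numFieldNormedType.Exports.

Local Open Scope classical_set_scope.
Local Open Scope ring_scope.

(* Writing K_a(x) = x^(a-1) e^(-lam x) / Gamma(a) for x > 0, the change of
   variable u = Psi(t) - Psi(0) turns the tempered integral of order a into
   convolution with K_a.  Euler's beta integral gives K_a * K_c = K_(a+c), hence
   the semigroup property of tempered integrals.  If D^(k alpha) f = G_k is
   continuous for all k, then by induction f is the tempered integral of order
   k alpha of G_k and G_(k+1) = D^alpha G_k: both follow from
   I^(1-alpha) G_k = I^1 G_(k+1), in which the constant of integration vanishes
   because the tempered integral of a continuous function is 0 at t = 0.
   For the same reason all initial values in the formula are 0, and what
   remains is the mean value theorem for
     f(t) = int_0^X K_(beta)(x) G(X - x) dx,  beta = (n+1) alpha,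
   together with int_0^X K_beta = e^(-lam X) X^beta E_(1,beta+1)(lam X), which
   comes from iterating int K_q = K_(q+1) + lam int K_(q+1).
   As Psi' may vanish on a null set, recovering y from its psi-derivative uses
   that a function differentiable everywhere with derivative 0 almost
   everywhere is constant. *)

(** * Densities and change of variable *)

(** Since Psi' may vanish, the inverse of Psi is continuous but in general not differentiable. The
    substitution is therefore treated as an identity of measures: the image of Psi'(s) ds under s
    |-> Psi(t) - Psi(s) is compared with Lebesgue measure on the rays [v, +oo[, where the comparison
    reduces to the fundamental theorem of calculus. For the same reason a differential equation
    divided by Psi' carries information only almost everywhere. The Cantor function shows that a
    continuous function with derivative 0 almost everywhere need not be constant; what excludes such
    behaviour is differentiability at every point, which is part of the existence of the
    psi-derivative. The kernel K_a is unbounded at 0 when a < 1, so the identities between kernels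
    are first proved for nonnegative functions in [\bar R] by Tonelli's theorem; finiteness and
    signed functions come afterwards. *)

Section density.
Local Open Scope ereal_scope.
Context d (T : measurableType d) (R : realType).
Variables (mu nu : {measure set T -> \bar R}) (w : T -> R).
Hypothesis w_ge0 : forall x, (0 <= w x)%R.
Hypothesis mw : measurable_fun setT w.
Hypothesis nuE : forall A, measurable A -> nu A = \int[mu]_(x in A) (w x)%:E.

Import HBNNSimple.

(** Monotone convergence on both sides reduces the identity to simple functions, and linearity
    reduces these to [nuE]. The lemma serves twice: for a weight on D, and for the restriction of
    Lebesgue measure to E, whose density is an indicator. *)
Lemma ge0_integral_density (f : T -> \bar R) :
  (forall x, 0 <= f x) -> measurable_fun setT f ->
  \int[nu]_x f x = \int[mu]_x ((w x)%:E * f x).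
Proof.
move=> f0 mf; pose h := nnsfun_approx measurableT mf.
have fE x : f x = limn (fun n => (h n x)%:E).
  by apply/esym/cvg_lim => //; exact: cvg_nnsfun_approx.
under eq_integral do rewrite fE.
rewrite monotone_convergence//; last 3 first.
- by move=> n; exact/measurable_EFinP.
- by move=> n x _; rewrite lee_fin.
- by move=> x _ a b ab; rewrite lee_fin; exact/lefP/nd_nnsfun_approx.
have wfE x : (w x)%:E * f x = limn (fun n => (w x)%:E * (h n x)%:E).
  apply/esym/cvg_lim => //; apply: cvgeZl => //.
  exact: (cvg_nnsfun_approx measurableT mf).
under [RHS]eq_integral do rewrite wfE.
rewrite monotone_convergence//; last 3 first.
- by move=> n; apply: emeasurable_funM; exact/measurable_EFinP.
- by move=> n x _; rewrite mule_ge0// lee_fin.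
- move=> x _ a b ab; rewrite lee_wpmul2l ?lee_fin//.
  exact/lefP/nd_nnsfun_approx.
suff suf n : \int[nu]_x (h n x)%:E = \int[mu]_x ((w x)%:E * (h n x)%:E).
  by under eq_fun do rewrite suf.
transitivity (\int[nu]_x
   (\sum_(y \in range (h n)) (y * \1_(h n @^-1` [set y]) x)%:E)).
  by apply: eq_integral => t tE; rewrite fimfunE -fsumEFin.
have indich m r : measurable_fun setT (fun x => (r * \1_(h m @^-1` [set r]) x)%:E).
  by apply/measurable_EFinP; exact: measurable_funM.
rewrite ge0_integral_fsum//; last by move=> m y Ey; exact: nnfun_muleindic_ge0.
transitivity (\int[mu]_x (\sum_(y \in range (h n))
    ((w x)%:E * (y * \1_(h n @^-1` [set y]) x)%:E))); last first.
  apply: eq_integral => x _; rewrite -ge0_mule_fsumr => [|y]; last first.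
    exact: nnfun_muleindic_ge0.
  by rewrite fsumEFin // -(fimfunE _ x).
rewrite ge0_integral_fsum//; last 2 first.
- by move=> y; apply: emeasurable_funM => //; exact/measurable_EFinP.
- by move=> m y Ey; rewrite mule_ge0 ?lee_fin// -lee_fin nnfun_muleindic_ge0.
apply: eq_fsbigr => r rhn.
under eq_integral do rewrite EFinM.
rewrite integralZl_indic_nnsfun// integral_indic// setIT.
under [RHS]eq_integral do rewrite EFinM muleCA.
rewrite ge0_integralZl//; last 3 first.
- by apply: emeasurable_funM; exact/measurable_EFinP.
- by move=> x _; rewrite mule_ge0// lee_fin.
- by case/set_mem: rhn => x _ <-; rewrite lee_fin.
congr (_ * _); rewrite nuE//.
under [RHS]eq_integral do rewrite -EFinM -[X in X%:E]/((w \* \1_(h n @^-1` [set r]))%R _).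
rewrite [LHS]integral_mkcond; apply: eq_integral => x _.
rewrite patchE /= indicE; case: ifPn => _; by rewrite ?mulr1 ?mulr0.
Qed.

End density.

Section substitution.
Local Open Scope ereal_scope.
Context (R : realType).
Notation mu := (@lebesgue_measure R).
Variables (D E : set R) (T w : R -> R).
Hypotheses (mD : measurable D) (mE : measurable E).
Hypothesis mT : measurable_fun setT T.
Hypothesis mw : measurable_fun setT w.
Hypothesis w_ge0 : forall x, (0 <= w x)%R.
Hypothesis wT : forall v : R,
  \int[mu]_(x in D `&` T @^-1` `[v, +oo[) (w x)%:E = mu (E `&` `[v, +oo[).
Hypothesis E_fin : mu E < +oo.

(** The image under T of w dx on D and Lebesgue measure on E agree on rays by [wT]. Rays [v, +oo[
    are stable under intersection and generate the Borel sets, and [E_fin] gives finite mass on the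
    exhausting rays [-n, +oo[, so the two measures coincide. *)
Lemma ge0_integral_subst (k : R -> \bar R) :
  (forall x, 0 <= k x) -> measurable_fun setT k ->
  \int[mu]_(x in D) ((w x)%:E * k (T x)) = \int[mu]_(x in E) k x.
Proof.
move=> k0 mk.
pose wD := (w \_ D)%R.
have wD0 x : (0 <= wD x)%R by rewrite /wD patchE; case: ifPn.
have mwD : measurable_fun setT wD.
  by apply/(measurable_restrictT _ _).1 => //; exact: measurable_funTS.
pose RM := measurableTypeR R.
pose nu (A : set RM) : \bar R := \int[mu]_(x in A) (wD x)%:E.
have nu0 : nu set0 = 0 by rewrite /nu integral_set0.
have nu_ge0 A : 0 <= nu A by apply: integral_ge0 => x _; rewrite lee_fin.
have nu_add : semi_sigma_additive nu.
  apply: (@semi_sigma_additive_nng_induced _ RM _ mu (EFin \o wD)).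
    exact/measurable_EFinP.
  by move=> x; rewrite lee_fin.
pose nuM := isMeasure.Build _ RM _ nu nu0 nu_ge0 nu_add.
pose numu : {measure set RM -> \bar R} := HB.pack nu nuM.
have -> : \int[mu]_(x in D) ((w x)%:E * k (T x)) = \int[numu]_x k (T x).
  rewrite (@ge0_integral_density _ _ _ mu numu wD)//; last first.
    exact: measurableT_comp.
  rewrite [LHS]integral_mkcond; apply: eq_integral => x _.
  by rewrite /wD !patchE; case: ifPn => // _; rewrite mul0e.
have mT' : measurable_fun [set: RM] (T : RM -> RM) by exact: mT.
have -> : \int[numu]_x k (T x) = \int[pushforward numu (T : RM -> RM)]_x k x.
  by rewrite ge0_integral_pushforward.
have -> : \int[mu]_(x in E) k x = \int[mrestr mu mE]_x k x.
  rewrite (@ge0_integral_density _ _ _ mu (mrestr mu mE) \1_E)//; last first.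
    by move=> A mA; rewrite integral_indic// setIC.
  rewrite [LHS]integral_mkcond; apply: eq_integral => x _.
  by rewrite patchE indicE; case: ifPn => // _; rewrite ?mul1e ?mul0e.
apply: eq_measure_integral => A mA _.
refine (@measure_unique _ R RM (@RGenCInfty.G R) (fun n => [set` `[(- n%:R)%R, +oo[%R]) _ _ _ _ _ _ _ _ _ mA).
- exact: RGenCInfty.measurableE.
- move=> _ _ [x ->] [y ->]; exists (Num.max x y).
  apply/seteqP; split => z /=; rewrite !in_itv /= !andbT ge_max; first by move=> [-> ->].
  by move/andP.
- by move=> n; exists (- n%:R)%R.
- apply/seteqP; split => // x _; exists (Num.truncn `|x|).+1 => //=.
  rewrite in_itv/= andbT lerNl (le_trans (ler_norm _))// normrN ltW//.
  exact: truncnS_gt.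
- move=> _ [v ->]. rewrite /= /pushforward /nu /mrestr setIC -wT.
  rewrite setIC integral_mkcondr; apply: eq_integral => x _.
  by rewrite /wD restrict_EFin.
- move=> n; rewrite /= /pushforward /nu.
  have := wT (- n%:R)%R; rewrite setIC integral_mkcondr.
  under eq_integral do rewrite restrict_EFin.
  by move=> ->; rewrite (le_lt_trans _ E_fin)// le_measure ?inE//; exact: measurableI.
Qed.
End substitution.

(** * Derivatives within an interval *)

Section WithinDerivative.
Context {R : realType}.
Implicit Types (b t l : R) (y z : R -> R).

(** Makes limits along this filter unique, so that [wderive] equals any limit that can be exhibited.
    A point near t is found on the side of the farther endpoint, which is at distance at least b /
    2. *)
Lemma within_itv_dnbhs_proper b t : 0 < b -> 0 <= t <= b ->
  ProperFilter (within `[0, b] t^').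
Proof.
move=> b0 /andP[t0 tb]; apply: Build_ProperFilter_ex => A.
rewrite /within/= => -[e /= e0 H].
pose m := Num.min (e / 2) (b / 2).
have m0 : 0 < m by rewrite lt_min !divr_gt0.
have me : m <= e / 2 by rewrite ge_min lexx.
have mb : m <= b / 2 by rewrite ge_min lexx orbT.
have [tb'|tb'] := leP t (b / 2).
- exists (t + m); apply: H; rewrite /=.
  + by rewrite opprD addNKr normrN gtr0_norm//; lra.
  + by rewrite gt_eqF// ltrDl.
  + by rewrite in_itv/=; apply/andP; split; lra.
- exists (t - m); apply: H; rewrite /=.
  + by rewrite opprB addrC subrK gtr0_norm//; lra.
  + by rewrite lt_eqF// ltrBlDr ltrDl.
  + by rewrite in_itv/=; apply/andP; split; lra.
Qed.

(** First-order expansion with the denominator cleared, so that s = t is no longer a special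
    case. *)
Lemma wquot_cvgP b y t l : 0 <= t <= b ->
  wquot b y t --> l <->
  forall e, 0 < e -> exists2 d, 0 < d &
    forall s, 0 <= s <= b -> `|s - t| < d ->
    `|y s - y t - l * (s - t)| <= e * `|s - t|.
Proof.
move=> t0b; rewrite /wquot; split.
  move=> /cvgrPdist_le H e e0; have [d /= d0 {}H] := H _ e0.
  exists d => // s s0b std; have [->|st] := eqVneq s t.
    by rewrite !subrr mulr0 subr0 normr0 mulr0.
  have := H s; rewrite /= distrC => /(_ std st); rewrite in_itv/= => /(_ s0b).
  have st0 : s - t != 0 by rewrite subr_eq0.
  rewrite -(ler_pM2r (_ : 0 < `|s - t|)) ?normr_gt0//; apply: le_trans.
  by rewrite -normrM mulrBl divfK// distrC.
move=> H; apply/cvgrPdist_le => /= e e0; have [d d0 {}H] := H _ e0.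
exists d => //= s; rewrite /= distrC => std st; rewrite in_itv/= => s0b.
have st0 : s - t != 0 by rewrite subr_eq0.
rewrite -(ler_pM2r (_ : 0 < `|s - t|)) ?normr_gt0//; apply: le_trans (H s s0b std).
by rewrite -normrM mulrBl divfK// distrC.
Qed.

Lemma wquot_lim b y t l : 0 < b -> 0 <= t <= b ->
  wquot b y t --> l -> wderivable b y t /\ wderive b y t = l.
Proof.
move=> b0 tb yl; have pF := within_itv_dnbhs_proper b0 tb.
split; first by apply/cvg_ex; exists l.
exact/cvg_lim.
Qed.

Lemma wderivable_cvg b y t : wderivable b y t -> wquot b y t --> wderive b y t.
Proof. by []. Qed.

Lemma eq_wquot b y z t : 0 <= t <= b ->
  (forall s, 0 <= s <= b -> y s = z s) -> wquot b y t = wquot b z t.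
Proof.
move=> tb yz; have E s : s \in `[0, b] -> y s = z s by rewrite in_itv; exact: yz.
have D : \forall s \near within `[0, b] t^', s \in `[0, b] by exact: withinT.
apply/seteqP; split=> A; rewrite /wquot /= => H; apply: filterS2 D H => s /= sb.
  by rewrite (yz t tb) (E s sb).
by rewrite (yz t tb) (E s sb).
Qed.

Lemma eq_wderivable b y z t : 0 <= t <= b ->
  (forall s, 0 <= s <= b -> y s = z s) -> wderivable b y t -> wderivable b z t.
Proof. by move=> tb yz; rewrite /wderivable (eq_wquot tb yz). Qed.

Lemma eq_wderive b y z t : 0 <= t <= b ->
  (forall s, 0 <= s <= b -> y s = z s) -> wderive b y t = wderive b z t.
Proof. by move=> tb yz; rewrite /wderive (eq_wquot tb yz). Qed.

Lemma wderivable_continuous b y :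
  (forall t, 0 <= t <= b -> wderivable b y t) -> {within `[0, b], continuous y}.
Proof.
move=> dy; apply/subspace_continuousP => t /=; rewrite in_itv/= => tb.
apply/cvgrPdist_le => /= e e0.
have /(wquot_cvgP _ _ tb)/(_ 1 ltr01)[d d0 H] := wderivable_cvg (dy t tb).
set l := wderive b y t in H.
have K0 : 0 < `|l| + 1 by rewrite ltr_wpDl.
exists (Num.min d (e / (`|l| + 1))) => /=; first by rewrite lt_min d0 divr_gt0.
move=> s /=; rewrite lt_min distrC => /andP[sd se]; rewrite in_itv/= => sb.
have {}H := H s sb sd; rewrite mul1r in H.
rewrite distrC -[y s - y t](subrK (l * (s - t))) (le_trans (ler_normD _ _))//.
rewrite (le_trans (lerD H (lexx _)))// normrM -[X in X + _]mul1r -mulrDl addrC.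
by rewrite mulrC -ler_pdivlMr// ltW.
Qed.

Lemma derive1_expand (h : R -> R) (x0 h' : R) :
  is_derive x0 1 h h' ->
  forall e, 0 < e -> exists2 d, 0 < d &
    forall x, `|x - x0| < d -> `|h x - h x0 - h' * (x - x0)| <= e * `|x - x0|.
Proof.
move=> [+ hE] e e0; rewrite /derivable => dh.
have {}dh : (fun k => k^-1 *: (h (k + x0) - h x0)) @ 0^' --> h'.
  rewrite -hE; suff -> : (fun k => k^-1 *: (h (k + x0) - h x0)) =
    (fun k => k^-1 *: ((h \o shift x0) (k *: 1) - h x0)) by exact: dh.
  by apply/funext => k /=; rewrite [k%:A]mulr1.
move/cvgrPdist_le : dh => /(_ e e0)[d /= d0 H].
exists d => // x xd; have [->|xx0] := eqVneq x x0.
  by rewrite !subrr mulr0 subrr normr0 mulr0.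
have xx0' : x - x0 != 0 by rewrite subr_eq0.
have := H (x - x0); rewrite /= sub0r normrN subrK => /(_ xd xx0').
rewrite -(ler_pM2r (_ : 0 < `|x - x0|)) ?normr_gt0//; apply: le_trans.
by rewrite -normrM mulrBl /GRing.scale/= mulrAC mulVf// mul1r distrC.
Qed.

Lemma wquot_comp b y h h' t l : 0 <= t <= b ->
  wquot b y t --> l -> is_derive (y t) 1 h h' ->
  wquot b (h \o y) t --> h' * l.
Proof.
move=> tb /(wquot_cvgP _ _ tb) yl dh; apply/(wquot_cvgP _ _ tb) => e e0.
have l1 : 0 < `|l| + 1 by rewrite ltr_wpDl.
have h1 : 0 < `|h'| + 1 by rewrite ltr_wpDl.
(* The two halves of e pay for the linearization of h and for that of y; adding 1 keeps the divisors
   positive when l or h' is 0. *)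
have [d1 d10 H1] := derive1_expand dh (divr_gt0 (divr_gt0 e0 (ltr0Sn R 1)) l1).
have [d2 d20 H2] := yl _ (divr_gt0 (divr_gt0 e0 (ltr0Sn R 1)) h1).
have [d3 d30 H3] := yl _ ltr01.
exists (Num.min (d1 / (`|l| + 1)) (Num.min d2 d3)).
  by rewrite !lt_min d20 d30 divr_gt0.
move=> s sb; rewrite !lt_min => /and3P[sd1 sd2 sd3] /=.
have ys : `|y s - y t| <= (`|l| + 1) * `|s - t|.
  rewrite -[y s - y t](subrK (l * (s - t))) (le_trans (ler_normD _ _))//.
  rewrite (le_trans (lerD (H3 s sb sd3) (lexx _)))// mul1r normrM.
  by rewrite -[X in X + _]mul1r -mulrDl addrC.
rewrite -[h (y s) - _](subrK (h' * (y s - y t))) -addrA -mulrA -mulrBr.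
rewrite (le_trans (ler_normD _ _))// (splitr e) mulrDl lerD//.
  rewrite (le_trans (H1 _ _))//.
    by rewrite (le_lt_trans ys)// mulrC -ltr_pdivlMr.
  rewrite mulrAC ler_pdivrMr// -[leRHS]mulrA ler_pM2l ?divr_gt0//.
  by rewrite (mulrC `|s - t|).
rewrite normrM (le_trans (ler_wpM2l _ (H2 _ _ _)))// mulrA.
rewrite ler_wpM2r// mulrCA ger_pMr ?divr_gt0// ler_pdivrMr// mul1r.
by rewrite lerDl.
Qed.

Lemma wquotD b y z t l m :
  wquot b y t --> l -> wquot b z t --> m -> wquot b (fun s => y s + z s) t --> l + m.
Proof.
move=> yl zm; rewrite /wquot.
apply: cvg_trans (cvgD yl zm); apply: near_eq_cvg; near=> s => /=.
by rewrite opprD addrACA mulrDl.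
Unshelve. all: by end_near. Qed.

Lemma wquotM b y z t l m : 0 <= t <= b ->
  wquot b y t --> l -> wquot b z t --> m ->
  wquot b (fun s => y s * z s) t --> l * z t + y t * m.
Proof.
rewrite /wquot => tb yl zm.
have sneq : \forall s \near within `[0, b] t^', s != t.
  by move: (nbhs_dnbhs_neq t); apply: filterS => s st _.
have s0 : s - t @[s --> within `[0, b] t^'] --> (0 : R).
  apply: (@cvg_trans _ ((s - t) @[s --> t])).
    by move=> A /= /nbhs_dnbhs At; move: At; apply: filterS => s As _.
  suff: s - t @[s --> t] --> t - t by rewrite subrr.
  by apply: cvgB; [exact: cvg_id|exact: cvg_cst].
(* Writing z s as z t plus its quotient times s - t lets its convergence to z t follow from the
   differentiability of z. *)
have : (fun s => (y s - y t) / (s - t) * (z t + (z s - z t) / (s - t) * (s - t)) + y t * ((z s - z t) / (s - t))) s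
   @[s --> within `[0, b] t^'] --> l * (z t + m * 0) + y t * m.
  apply: cvgD; last by apply: cvgM => //; exact: cvg_cst.
  apply: cvgM => //; apply: cvgD; first exact: cvg_cst.
  exact: cvgM.
rewrite mulr0 addr0; apply: cvg_trans; apply: near_eq_cvg; near=> s => /=.
have st : s - t != 0 by rewrite subr_eq0; near: s; exact: sneq.
by field.
Unshelve. all: by end_near. Qed.

End WithinDerivative.

(** * Functions with zero derivative almost everywhere *)

Section AeZeroDerivative.
Context {R : realType}.
Notation mu := (@lebesgue_measure R).

(* Cousin's lemma. *)
Lemma interval_local_to_global (b : R) (P : R -> R -> Prop) : 0 <= b ->
  (forall u v w, 0 <= u -> u <= v -> v <= w -> w <= b -> P u v -> P v w -> P u w) ->
  (forall t, 0 <= t <= b -> exists2 d, 0 < d &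
    forall u v, 0 <= u -> u <= t -> t <= v -> v <= b -> v - u < d -> P u v) ->
  forall t, 0 <= t <= b -> P 0 t.
Proof.
move=> b0 Ptrans Ploc t /andP[t0 tb].
pose S := [set s | 0 <= s <= t /\ P 0 s].
have S0 : S 0.
  split; first by rewrite lexx.
  have [|d d0] := Ploc 0; first by rewrite lexx.
  by apply => //; rewrite subrr.
have supS : has_sup S by split; [exists 0|exists t => s [/andP[]]].
pose c := sup S.
have c0 : 0 <= c by apply: ub_le_sup => //; case: supS.
have ct : c <= t by apply: ge_sup; [exists 0|move=> s [/andP[]]].
have [|d d0 Pd] := Ploc c; first by rewrite c0 (le_trans ct).
have [s [/andP[s0 st] Ps] cs] := sup_adherent d0 supS.
have sc : s <= c by apply: ub_le_sup; [case: supS|split; rewrite ?s0].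
have Pc : P 0 c.
  apply: (Ptrans 0 s c) => //; first exact: le_trans tb.
  by apply: Pd => //; [exact: le_trans tb|rewrite ltrBlDr -ltrBlDl].
have [tc|{}ct] := leP t c; first by rewrite (le_anti (introT andP (conj tc ct))).
(* If c < t, the local property at c carries [P] beyond c, against the choice of c as supremum. *)
pose v := Num.min t (c + d / 2).
have cv : c < v by rewrite lt_min ct ltrDl divr_gt0.
have vt : v <= t by rewrite ge_min lexx.
suff : v <= c by rewrite leNgt cv.
apply: ub_le_sup; [by case: supS|split; first by rewrite vt (le_trans c0 (ltW cv))].
apply: (Ptrans 0 c v) => //; rewrite ?(ltW cv) ?(le_trans vt)//.
apply: Pd => //; rewrite ?(ltW cv) ?(le_trans vt)//.
rewrite ltrBlDl (@le_lt_trans _ _ (c + d / 2)) ?ge_min ?lexx ?orbT//.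
by rewrite ltrD2l ltr_pdivrMr// ltr_pMr// ltr1n.
Qed.

(* Since [K] is arbitrary, [g] has infinite derivative on [N], so it dominates
   near [N] any function differentiable there. *)
Lemma null_set_steep (N : set R) (e : R) : measurable N -> mu N = 0%E -> 0 < e ->
  exists g : R -> R, [/\ {homo g : x y / x <= y}, forall x, 0 <= g x <= e &
    forall t (K : nat), N t -> exists2 d, 0 < d &
      forall u v, u <= t -> t <= v -> v - u < d -> K%:R * (v - u) <= g v - g u].
Proof.
move=> mN N0 e0.
have e2 k : 0 < e / (2 ^ k.+1)%:R by rewrite divr_gt0// ltr0n expn_gt0.
have /choice[U HU] : forall k : nat, exists U : set R,
    [/\ open U, N `<=` U & (mu U <= (e / (2 ^ k.+1)%:R)%:E)%E].
  move=> k; have [|U [oU NU UN]] := lebesgue_regularity_outer mN _ (e2 k).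
    by rewrite (_ : _ N = 0%E) ?ltry.
  exists U; split => //; rewrite -(setDUK NU) (le_trans (measureU2 _ _ _))//.
    exact: measurableD (open_measurable oU) mN.
  by rewrite [X in (X + _)%E](_ : _ = 0%E)// add0e ltW.
have oU k : open (U k) by case: (HU k).
have NU k : N `<=` U k by case: (HU k).
have mU k : measurable (U k) by exact: open_measurable.
have muU k : (mu (U k) <= (e / (2 ^ k.+1)%:R)%:E)%E by case: (HU k).
(* [g] will be the sum over k of the measure of the part of [U k] left of x. Near a point of N the
   first K open sets all contain the interval, so each contributes slope 1; the measures, at most e
   / 2^(k+1), sum to at most e. *)
pose f x k := mu (U k `&` `]-oo, x]).
have mUx k x : measurable (U k `&` `]-oo, x]) by exact: measurableI.
pose G x := (\sum_(0 <= k <oo) f x k)%E.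
have fle x k : (f x k <= (e / (2 ^ k.+1)%:R)%:E)%E.
  apply: le_trans (muU k); by rewrite /f le_measure ?inE//; [exact: mUx|exact: mU].
have Gle x : (G x <= e%:E)%E.
  apply: (@le_trans _ _ (\sum_(0 <= k <oo) (e / (2 ^ k.+1)%:R)%:E)%E).
    by apply: lee_nneseries => [k _ _|k _]; [exact: measure_ge0|exact: fle].
  exact/epsilon_trick0/ltW.
have G0 x : (0 <= G x)%E by apply: nneseries_ge0 => k _ _; exact: measure_ge0.
have Gfin x : G x \is a fin_num by rewrite ge0_fin_numE// (le_lt_trans (Gle x)) ?ltry.
have fmono k x y : x <= y -> (f x k <= f y k)%E.
  move=> xy; rewrite /f le_measure ?inE//; [exact: mUx|exact: mUx|].
  by apply: setIS => z /=; rewrite !in_itv/= => /le_trans; apply.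
exists (fine \o G); split.
- move=> x y xy /=; apply: fine_le => //; apply: lee_nneseries => [k _ _|k _].
    exact: measure_ge0.
  exact: fmono.
- by move=> x /=; rewrite fine_ge0//= -lee_fin fineK.
move=> t K Nt.
have [d d0 Hd] : exists2 d, 0 < d & forall x, `|x - t| < d -> forall k, (k < K)%N -> U k x.
  elim: K => [|K [d d0 IH]]; first by exists 1.
  have /nbhs_ballP[d' /= d'0 H'] : nbhs t (U K) by apply: open_nbhs_nbhs; split; [exact: oU|exact: NU].
  exists (Num.min d d'); first by rewrite lt_min d0.
  move=> x; rewrite lt_min => /andP[xd xd'] k; rewrite ltnS leq_eqVlt => /predU1P[->|].
    by apply: H'; rewrite /ball/= distrC.
  exact: IH.
exists d => // u v ut tv vud.
have uv : u <= v by exact: le_trans tv.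
have fuv k : (k < K)%N -> (f u k + (v - u)%:E <= f v k)%E.
  move=> kK; rewrite /f.
  have -> : U k `&` `]-oo, v] = (U k `&` `]-oo, u]) `|` `]u, v].
    apply/seteqP; split=> x /=; rewrite !in_itv/=.
      by move=> [Ukx ->]; rewrite andbT; case: (leP x u) => xu; [left|right].
    case=> [[Ukx xu]|/andP[ux xv]]; first by split => //; exact: le_trans uv.
    split => //; apply: Hd kK.
    by rewrite ltr_norml; apply/andP; split; lra.
  rewrite measureU; [|exact: mUx|exact: measurable_itv|]; last first.
    apply/seteqP; split => x //=; rewrite !in_itv/= => -[[_ xu] /andP[ux _]].
    by move: ux; rewrite ltNge xu.
  apply: leeD2l.
  have muuv : mu `]u, v] = (v - u)%:E.
    rewrite lebesgue_measure_itv/= lte_fin; case: ltP => [_|vu]; first by rewrite EFinB.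
    by rewrite (le_anti (introT andP (conj uv vu))) subrr.
  rewrite le_eqVlt; apply/orP; left; apply/eqP; exact: esym muuv.
rewrite lerBrDr addrC -lee_fin EFinD !fineK//.
rewrite /G !(@nneseries_split _ _ 0 K)//; try by move=> k _; exact: measure_ge0.
rewrite !add0n addeAC leeD//; last first.
  by apply: lee_nneseries => [k _ _|k _]; [exact: measure_ge0|exact: fmono].
rewrite (@le_trans _ _ (\sum_(0 <= k < K) (f u k + (v - u)%:E))%E)//.
  rewrite big_split/= leeD2l//.
  rewrite sumEFin big_const_nat subn0 iter_addr addr0 lee_fin.
  by rewrite mulr_natl.
by rewrite big_nat_cond [leRHS]big_nat_cond lee_sum// => k /andP[/andP[_ kK] _]; exact: fuv.
Qed.

(** The increment of z is compared with that of a small steep monotone g plus a small multiple of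
    the length. This bound is additive over adjacent intervals, so it need only be checked near each
    point: off N the length term suffices because z' = 0, and on N the steepness of g does. *)
Lemma wderive_ae0_cst (b : R) (z : R -> R) : 0 < b ->
  (forall t, 0 <= t <= b -> wderivable b z t) ->
  {ae mu, forall t, 0 <= t <= b -> wderive b z t = 0} ->
  forall t, 0 <= t <= b -> z t = z 0.
Proof.
move=> b0 dz [N [mN N0 NP]] t tb; apply/eqP; rewrite -subr_eq0 -normr_le0.
apply/ler_addgt0Pl => e e0; rewrite addr0.
(* g contributes at most e / (b + 1) and the length term at most b times that, which together make
   e. *)
have e10 : 0 < e / (b + 1) by rewrite divr_gt0// ltr_wpDl// ltW.
have [g [gmono g01 gsteep]] := null_set_steep mN N0 e10.
pose P u v := `|z v - z u| <= (g v - g u) + e / (b + 1) * (v - u).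
have Pt : P 0 t.
  apply: (@interval_local_to_global b P (ltW b0) _ _ t tb).
    move=> u v w _ _ _ _ Puv Pvw; rewrite /P -(subrK (z v) (z w)) -addrA.
    rewrite (le_trans (ler_normD _ _))// (le_trans (lerD Pvw Puv))//; lra.
  move=> s sb; have zs := wderivable_cvg (dz s sb).
  have [Ns|Ns] := pselect (N s); last first.
    have z0 : wderive b z s = 0 by apply: contrapT => H; apply/Ns/NP => /= /(_ sb).
    have [d d0 H] := (wquot_cvgP _ _ sb).1 zs _ e10; exists d => // u v u0 us sv vb vud.
    have ub : 0 <= u <= b by rewrite u0/=; lra.
    have vb' : 0 <= v <= b by rewrite vb andbT; lra.
    have := H u ub; have := H v vb'; rewrite z0 !mul0r !subr0.
    rewrite (@ger0_norm _ (v - s)) ?subr_ge0// (@ler0_norm _ (u - s)) ?subr_le0//.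
    move=> /(_ ltac:(lra)) Hv /(_ ltac:(lra)) Hu.
    have guv := gmono _ _ (le_trans us sv); rewrite /P -(subrK (z s) (z v)) -addrA.
    rewrite (le_trans (ler_normD _ _))// (distrC _ (z u)).
    have E : e / (b + 1) * (v - u) = e / (b + 1) * (v - s) + e / (b + 1) * - (u - s) by ring.
    by rewrite E (le_trans (lerD Hv Hu))// lerDr subr_ge0.
  (* On N nothing is known about the value l of the derivative; z is Lipschitz at s with constant
     [|l| + 1], and g is taken steeper than that. *)
  have [d d0 H] := (wquot_cvgP _ _ sb).1 zs _ ltr01.
  set l := wderive b z s in H.
  have [d' d'0 H'] := gsteep s (Num.truncn (`|l| + 1)).+1 Ns.
  exists (Num.min d d'); first by rewrite lt_min d0.
  move=> u v u0 us sv vb; rewrite lt_min => /andP[vud vud'].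
  have {}H' := H' u v us sv vud'.
  have ub : 0 <= u <= b by rewrite u0/=; lra.
  have vb' : 0 <= v <= b by rewrite vb andbT; lra.
  have L x : 0 <= x <= b -> `|x - s| < d -> `|z x - z s| <= (`|l| + 1) * `|x - s|.
    move=> xb xd; rewrite -[z x - z s](subrK (l * (x - s))) (le_trans (ler_normD _ _))//.
    by rewrite (le_trans (lerD (H x xb xd) (lexx _)))// normrM mulrDl addrC.
  have := L u ub; have := L v vb'.
  rewrite (@ger0_norm _ (v - s)) ?subr_ge0// (@ler0_norm _ (u - s)) ?subr_le0//.
  move=> /(_ ltac:(lra)) Hv /(_ ltac:(lra)) Hu.
  rewrite /P -(subrK (z s) (z v)) -addrA.
  rewrite (le_trans (ler_normD _ _))// (distrC _ (z u)).
  have vu0 : 0 <= v - u by rewrite subr_ge0 (le_trans us).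
  have E : (`|l| + 1) * (v - u) = (`|l| + 1) * (v - s) + (`|l| + 1) * - (u - s) by ring.
  rewrite (le_trans (lerD Hv Hu))// -E -[leLHS]addr0 lerD//; last by apply: mulr_ge0 => //; exact: ltW.
  by apply: le_trans H'; rewrite ler_wpM2r// ltW// truncnS_gt.
rewrite (le_trans Pt)// subr0.
have /andP[gt0 gte] := g01 t; have /andP[g00 _] := g01 0; have /andP[t0 tb'] := tb.
rewrite (@le_trans _ _ (e / (b + 1) * (1 + b)))//; last by rewrite addrC divfK// gt_eqF//; lra.
by rewrite mulrDr mulr1 lerD// ?ler_pM2l//; lra.
Qed.

End AeZeroDerivative.

(** * The tempered kernel *)

Section Kernel.
Context {R : realType}.
Notation mu := (@lebesgue_measure R).
Implicit Types (a c lam x w X : R).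

(** The image of Lebesgue measure under translation has the same value on half-open intervals, which
    determines it. *)
Lemma ge0_integral_translation (k : R -> \bar R) x :
  (forall y, 0%R <= k y)%E -> measurable_fun setT k ->
  (\int[mu]_y k y = \int[mu]_w k (w - x)%R)%E.
Proof.
move=> k0 mk.
pose RM := measurableTypeR R; pose T (w : RM) : RM := w - x.
have mT : measurable_fun [set: RM] T.
  by apply: measurable_funB => //; exact: measurable_cst.
transitivity (\int[pushforward mu T]_y k y)%E; last first.
  by rewrite ge0_integral_pushforward.
apply: eq_measure_integral => A mA _.
apply: lebesgue_measure_unique => //; last first.
  move=> B /ocitvP[->|[[u v] /= uv ->]]; first by rewrite !measure0.
  rewrite /pushforward.
  have -> : T @^-1` `]u, v] = `]u + x, v + x]%classic.
    by apply/seteqP; split => w /=; rewrite !in_itv/= /T ltrBrDr lerBlDr.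
  have e1 : mu `]u, v] = (v - u)%:E.
    by rewrite lebesgue_measure_itv/= lte_fin uv EFinB.
  have e2 : mu `]u + x, v + x] = (v - u)%:E.
    by rewrite lebesgue_measure_itv/= lte_fin ltrD2r uv -EFinB opprD addrACA subrr addr0.
  exact: etrans e1 (esym e2).
Qed.

Lemma measurable_fun_compB (g : R -> R) :
  measurable_fun setT g -> measurable_fun setT (fun z : R * R => g (z.2 - z.1)).
Proof.
move=> mg; apply: (measurableT_comp mg).
by apply: measurable_funB; [exact: measurable_snd|exact: measurable_fst].
Qed.

(** Translate the inner variable to w = x + y and exchange the integrals. With h = 1 this says that
    the mass of a convolution is the product of the masses, whence the beta-gamma relation; with
    kernels for f and g it gives the semigroup property. *)
Lemma ge0_convolutionA (f g h : R -> R) X :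
  (forall x, 0 <= f x) -> (forall x, 0 <= g x) -> (forall x, 0 <= h x) ->
  measurable_fun setT f -> measurable_fun setT g -> measurable_fun setT h ->
  (\int[mu]_x ((f x)%:E * \int[mu]_y (g y * h (X - x - y))%:E) =
   \int[mu]_w ((\int[mu]_x (f x * g (w - x))%:E) * (h (X - w))%:E))%E.
Proof.
move=> f0 g0 h0 mf mg mh.
have mhX x : measurable_fun [set: R] (fun y : R => h (x - y)).
  by apply: (measurableT_comp mh); apply: measurable_funB => //; exact: measurable_cst.
have mgX x : measurable_fun [set: R] (fun y : R => g (x - y)).
  by apply: (measurableT_comp mg); apply: measurable_funB => //; exact: measurable_cst.
have mgX' x : measurable_fun [set: R] (fun y : R => g (y - x)).
  by apply: (measurableT_comp mg); apply: measurable_funB => //; exact: measurable_cst.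
transitivity (\int[mu]_x \int[mu]_w (f x * g (w - x) * h (X - w))%:E)%E.
  apply: eq_integral => x _.
  rewrite (@ge0_integral_translation _ x); last 2 first.
  - by move=> y; rewrite lee_fin mulr_ge0.
  - by apply/measurable_EFinP; apply: measurable_funM.
  rewrite -ge0_integralZl//; last 3 first.
  - apply/measurable_EFinP; apply: measurable_funM; first exact: mgX'.
    have := mhX X; apply: eq_measurable_fun => w _ /=; congr h; ring.
  - by move=> y _; rewrite lee_fin mulr_ge0.
  - by rewrite lee_fin.
  by apply: eq_integral => w _; rewrite -EFinM mulrA; congr (_ * h _)%:E; ring.
have mF : measurable_fun setT (fun z : R * R => (f z.1 * g (z.2 - z.1) * h (X - z.2))%:E).
  apply/measurable_EFinP; apply: measurable_funM; last first.
    exact: (measurableT_comp (mhX X) measurable_snd).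
  apply: measurable_funM; last exact: measurable_fun_compB.
  exact: (measurableT_comp mf measurable_fst).
have := @fubini_tonelli _ _ _ _ R mu mu _ mF.
move=> -> /=; last by move=> z; rewrite lee_fin !mulr_ge0.
apply: eq_integral => w _.
under eq_integral do rewrite EFinM muleC.
rewrite ge0_integralZl//; last 3 first.
- by apply/measurable_EFinP; apply: measurable_funM; [exact: mf|exact: mgX].
- by move=> y _; rewrite lee_fin mulr_ge0.
- by rewrite lee_fin.
by rewrite muleC.
Qed.

(** For a < 1 the integrand is unbounded at 0, so the fundamental theorem is applied on [s, X] with
    s > 0, and s decreases to 0 by monotone convergence over increasing domains. *)
Lemma integral_powR_itv a X : 0 < a -> 0 < X ->
  (\int[mu]_(x in `]0%R, X]) (x `^ (a - 1))%R%:E = (X `^ a / a)%R%:E)%E.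
Proof.
move=> a0 X0.
have dpow c s : 0 < s -> {in `[s, X], forall x : R, derivable (fun y : R => y `^ c) x 1}.
  move=> s0 x; rewrite in_itv/= => /andP[sx _].
  by apply: derivable_powR; rewrite in_itv/= andbT (lt_le_trans s0).
have step s : 0 < s -> s < X ->
    (\int[mu]_(x in `[s, X]) (x `^ (a - 1))%R%:E = (X `^ a / a)%R%:E - (s `^ a / a)%R%:E)%E.
  move=> s0 sX; rewrite (@continuous_FTC2 _ _ (fun x => x `^ a / a) s X)//.
  - by apply: derivable_within_continuous; exact: dpow.
  - have dF : {in `[s, X], forall x : R, derivable (fun x => x `^ a / a) x 1}.
      by move=> x xsX; apply: derivableM => //; exact: dpow xsX.
    have /(continuous_within_itvP _ sX)[_ cr cl] := derivable_within_continuous dF.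
    by split => // x xsX; apply: dF; exact: subset_itv_oo_cc.
  - move=> x; rewrite in_itv/= => /andP[sx _]; have x0 : 0 < x by exact: lt_trans sx.
    have x0' : x \in `]0, +oo[ by rewrite in_itv/= andbT.
    rewrite derive1Mr; last exact: derivable_powR.
    by rewrite powR_derive1// mulrAC mulfV ?mul1r// gt_eqF.
(* The denominator n + 2 keeps s n strictly below X, as [step] requires, already for n = 0. *)
pose s n : R := X * n.+2%:R^-1.
have s0 n : 0 < s n by rewrite mulr_gt0.
have sX n : s n < X by rewrite gtr_pMr// invf_lt1// ltr1n.
have scvg : s n @[n --> \oo] --> (0 : R).
  rewrite -(mulr0 X); apply: cvgMr.
  have := @cvg_harmonic R; rewrite -cvg_shiftS; exact.
have scvg' : s n `^ a @[n --> \oo] --> (0 : R).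
  by have /cvg_at_rightP := powR_cvg0 a0; apply.
pose F n := [set` `[s n, X]].
have UF : \bigcup_n F n = [set` `]0, X]].
  apply/seteqP; split => x /=.
    by move=> [n _]; rewrite /F/= !in_itv/= => /andP[sx ->]; rewrite (lt_le_trans (s0 n)).
  rewrite in_itv/= => /andP[x0 xX]; exists (Num.truncn (X / x)) => //.
  rewrite /F/= in_itv/= xX andbT /s ler_pdivrMr// mulrC -ler_pdivrMr//.
  by rewrite ltW// (lt_trans (truncnS_gt _))// ltr_nat.
have ndF : nondecreasing_seq F.
  move=> m n mn; apply/subsetPset => x; rewrite /F/= !in_itv/= => /andP[sx ->]; rewrite andbT.
  by apply: le_trans sx; rewrite /s ler_pM2l// lef_pV2 ?posrE// ler_nat !ltnS.
have mpow : measurable_fun [set: R] (fun x => (x `^ (a - 1))%:E).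
  by apply/measurable_EFinP; exact: measurable_powR.
have H : (\int[mu]_(x in F n) (x `^ (a - 1))%R%:E @[n --> \oo] -->
          \int[mu]_(x in \bigcup_n F n) (x `^ (a - 1))%R%:E)%E.
  apply: ge0_nondecreasing_set_cvg_integral => //.
  - by move=> n; exact: measurable_itv.
  - by move=> n; exact: measurable_funTS.
  - by move=> n x _; rewrite lee_fin powR_ge0.
rewrite UF in H.
apply: cvg_unique H _ => //.
rewrite (_ : (fun _ => _) = (fun n => (X `^ a / a - s n `^ a / a)%:E)); last first.
  by apply/funext => n; rewrite step.
apply: cvg_EFin; first exact: nearW.
rewrite -[X in _ --> X]subr0; apply: cvgB; first exact: cvg_cst.
by rewrite -(mul0r a^-1); apply: cvgMl.
Qed.

(* The cut-off at 0 is needed: [x `^ r] is 1 for x < 0. *)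
Definition tker lam a x : R := if 0 < x then x `^ (a - 1) * expR (- lam * x) else 0.

Lemma tker_ge0 lam a x : 0 <= tker lam a x.
Proof. by rewrite /tker; case: ifP => // _; rewrite mulr_ge0 ?powR_ge0 ?expR_ge0. Qed.

Lemma measurable_tker lam a : measurable_fun setT (tker lam a).
Proof.
apply: measurable_fun_ifT => //=.
- by apply: measurable_fun_ltr => //; exact: measurable_cst.
- apply: measurable_funM; first exact: measurable_powR.
  by apply: (measurableT_comp (@measurable_expR R)); apply: measurable_funM => //; exact: measurable_cst.
Qed.

End Kernel.

(** * Euler's beta and gamma integrals *)

Section GammaBeta.
Context {R : realType}.
Notation mu := (@lebesgue_measure R).
Implicit Types (a c lam x w X : R).

(** The two exponentials multiply to exp(-lam w), which is free of u, and the powers of w factor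
    out; the leading w is the Jacobian of x = w u. What depends on u is a pure beta integrand. *)
Lemma tker0_scale a c lam w u : 0 < w ->
  w * (tker lam a (w * u) * tker lam c (w - w * u)) =
  tker lam (a + c) w * (tker 0 a u * tker 0 c (1 - u)).
Proof.
move=> w0; have -> : w - w * u = w * (1 - u) by ring.
rewrite /tker w0.
rewrite !pmulr_rgt0//; case: ifP => u0; last by rewrite !mul0r !mulr0.
case: ifP => u1; last by rewrite !mulr0.
rewrite !powRM ?(ltW w0) ?(ltW u0) ?(ltW u1)// oppr0 !mul0r expR0 !mulr1.
have -> : w `^ (a + c - 1) = w * w `^ (a - 1) * w `^ (c - 1).
  rewrite -[X in X * _ * _]powRr1 ?(ltW w0)// -!powRD ?(gt_eqF w0) ?implybT//.
  by congr (_ `^ _); ring.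
have -> : expR (- lam * w) = expR (- lam * (w * u)) * expR (- lam * (w * (1 - u))).
  by rewrite -expRD; congr expR; ring.
by ring.
Qed.

Lemma lebesgue_measure_itvcc_Icy (x y v : R) : x <= y ->
  mu (`[x, y] `&` `[v, +oo[) = (Num.max 0 (y - Num.max x v))%:E.
Proof.
move=> xy.
have -> : `[x, y] `&` `[v, +oo[ = `[Num.max x v, y]%classic.
  apply/seteqP; split => z /=; rewrite !in_itv/= ge_max andbT.
    by move=> [/andP[-> ->] ->].
  by move=> /andP[/andP[-> ->] ->].
rewrite lebesgue_measure_itv/= lte_fin; case: ifPn => [lt|].
  by rewrite -EFinB (@max_r _ _ 0)// subr_ge0 ltW.
by rewrite -leNgt => le; rewrite (@max_l _ _ 0)// subr_le0.
Qed.

(** Euler's beta integral: the cut-offs in [tker] confine u to ]0, 1[. It lives in [\bar R] because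
    its finiteness is obtained only through Gamma, in [tbetaE]. *)
Definition tbeta a c : \bar R := (\int[mu]_u (tker 0 a u * tker 0 c (1 - u))%R%:E)%E.

Lemma measurable_tker_convol lam a c w :
  measurable_fun [set: R] (fun x : R => tker lam a x * tker lam c (w - x)).
Proof.
apply: measurable_funM; first exact: measurable_tker.
apply: (measurableT_comp (measurable_tker lam c)).
by apply: measurable_funB => //; exact: measurable_cst.
Qed.

Lemma tker_convol lam a c w :
  (\int[mu]_x (tker lam a x * tker lam c (w - x))%R%:E =
   (tker lam (a + c) w)%:E * tbeta a c)%E.
Proof.
have [w0|w0] := leP w 0.
  have -> : tker lam (a + c) w = 0 by rewrite /tker ltNge w0.
  rewrite mul0e integral0_eq// => x _.
  rewrite /tker; case: ifP => x0; last by rewrite mul0r.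
  by rewrite ifF ?mulr0// subr_gt0; apply/negbTE; rewrite -leNgt (le_trans w0)// ltW.
transitivity (\int[mu]_(x in `[0%R, w]) (tker lam a x * tker lam c (w - x))%R%:E)%E.
  rewrite [RHS]integral_mkcond; apply: eq_integral => x _; rewrite patchE.
  case: ifPn => //; rewrite notin_setE/= in_itv/= => /negP; rewrite negb_and -!ltNge.
  by rewrite /tker subr_gt0 => /orP[/lt_gtF|/lt_gtF] ->; rewrite ?mul0r ?mulr0.
have mT : measurable_fun [set: R] (fun u : R => w * u).
  by apply: measurable_funM => //; exact: measurable_cst.
have wT v : (\int[mu]_(x in `[0%R, 1%R] `&` (fun u => w * u)%R @^-1` `[v, +oo[) (cst w x)%:E =
    mu (`[0%R, w] `&` `[v, +oo[))%E.
  have -> : (fun u => w * u) @^-1` `[v, +oo[ = `[v / w, +oo[%classic.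
    by apply/seteqP; split => x /=; rewrite !in_itv/= !andbT ler_pdivrMr// mulrC.
  transitivity (w%:E * mu (`[0%R, 1%R] `&` `[(v / w)%R, +oo[))%E.
    have mI : measurable (`[0%R, 1%R] `&` `[(v / w)%R, +oo[ : set R) by apply: measurableI; exact: measurable_itv.
    exact: (integral_cst mu mI w%:E).
  rewrite (lebesgue_measure_itvcc_Icy _ ler01) (lebesgue_measure_itvcc_Icy _ (ltW w0)).
  rewrite -EFinM; congr (_%:E); rewrite maxr_pMr ?(ltW w0)// mulr0 mulrBr mulr1.
  by rewrite maxr_pMr ?(ltW w0)// mulr0 mulrCA divff ?mulr1// gt_eqF.
have Ew : (mu `[0%R, w] < +oo)%E by rewrite lebesgue_measure_itv/= lte_fin w0 sube0 ltry.
rewrite -(@ge0_integral_subst R `[0%R, 1%R] `[0%R, w] (fun u => w * u) (cst w)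
    (measurable_itv _) (measurable_itv _) mT _ (fun=> ltW w0) wT Ew
    (fun x => (tker lam a x * tker lam c (w - x))%:E))//; last 2 first.
- by move=> x; rewrite lee_fin mulr_ge0 ?tker_ge0.
- by apply/measurable_EFinP; exact: measurable_tker_convol.
under eq_integral do rewrite -EFinM [cst w _]/= tker0_scale// EFinM.
rewrite ge0_integralZl//; last 3 first.
- by apply: measurable_funTS; apply/measurable_EFinP; exact: measurable_tker_convol.
- by move=> x _; rewrite lee_fin mulr_ge0 ?tker_ge0.
- by rewrite lee_fin tker_ge0.
congr (_ * _)%E; rewrite [LHS]integral_mkcond; apply: eq_integral => x _; rewrite patchE.
case: ifPn => //; rewrite notin_setE/= in_itv/= => /negP; rewrite negb_and -!ltNge.
by rewrite /tker subr_gt0 => /orP[/lt_gtF|/lt_gtF] ->; rewrite ?mul0r ?mulr0.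
Qed.

(* tgamma is Euler's integral as an extended real, so that Tonelli applies before
   finiteness is known. *)
Definition tgamma a : \bar R := (\int[mu]_x (tker 1 a x)%:E)%E.

Lemma tgammaE a : tgamma a = (\int[mu]_(x in `]0%R, +oo[) (x `^ (a - 1) * expR (- x))%R%:E)%E.
Proof.
rewrite [RHS]integral_mkcond; apply: eq_integral => x _; rewrite patchE /tker.
have [x0|x0] := ltP 0 x; first by rewrite ifT ?mulN1r// inE/= in_itv/= x0.
by rewrite ifF//; apply/negbTE; rewrite notin_setE/= in_itv/= andbT; apply/negP; rewrite -leNgt.
Qed.

(** Both sides are the total mass of the convolution of [tker 1 a] and [tker 1 c], computed as a
    product of masses and through [tker_convol]. *)
Lemma tgammaM a c : (tgamma a * tgamma c = tbeta a c * tgamma (a + c))%E.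
Proof.
have m1 : measurable_fun [set: R] (cst (1 : R)) by exact: measurable_cst.
have := @ge0_convolutionA R (tker 1 a) (tker 1 c) (cst 1) 0 (tker_ge0 1 a) (tker_ge0 1 c)
  (fun=> ler01) (measurable_tker 1 a) (measurable_tker 1 c) m1.
under eq_integral do under eq_integral do rewrite /= mulr1.
under [RHS]eq_integral do rewrite /= mule1 tker_convol muleC.
rewrite ge0_integralZr//; last 3 first.
- by apply/measurable_EFinP; exact: measurable_tker.
- by move=> x _; rewrite lee_fin tker_ge0.
- by apply: integral_ge0 => x _; rewrite lee_fin tker_ge0.
move=> ->; rewrite ge0_integralZl//.
- by apply/measurable_EFinP; exact: measurable_tker.
- by move=> x _; rewrite lee_fin tker_ge0.
- by apply: integral_ge0 => x _; rewrite lee_fin mulr_ge0 ?tker_ge0.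
Qed.

Lemma tbetar1 a : 0 < a -> tbeta a 1 = (a^-1)%:E.
Proof.
move=> a0; have := integral_powR_itv a0 ltr01; rewrite powR1 mul1r => <-.
rewrite -integral_itv_bndo_bndc; last first.
  by apply/measurable_EFinP; apply: measurable_funTS; exact: measurable_powR.
rewrite [RHS]integral_mkcond; apply: eq_integral => x _; rewrite patchE; case: ifPn.
  rewrite inE/= in_itv/= => /andP[x0 x1].
  by rewrite /tker x0 subr_gt0 x1 subrr powRr0 oppr0 !mul0r expR0 !mulr1.
rewrite notin_setE/= in_itv/= => /negP; rewrite negb_and -!leNgt /tker subr_gt0.
by move=> /orP[|]; rewrite leNgt => /negbTE ->; rewrite ?mul0r ?mulr0.
Qed.

(** The total mass of the exponential law of rate 1. *)
Lemma tgamma1 : tgamma 1 = 1%E.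
Proof.
rewrite tgammaE integral_itv_obnd_cbnd; last first.
  apply/measurable_EFinP; apply: measurable_funTS; apply: measurable_funM.
    exact: measurable_powR.
  by apply: (measurableT_comp (@measurable_expR R)); apply: measurable_funN.
rewrite -(@integral_exponential_pdf R 1 ltr01) [LHS]integral_mkcond; apply: eq_integral => x _.
by rewrite /exponential_pdf !patchE; case: ifPn => _; rewrite ?subrr ?powRr0 ?mulN1r.
Qed.

(** On [1, 2] the power is at least 1 / x, hence at least 1 / 2, since a - 1 >= -1, and the
    exponential is at least exp(-2). *)
Lemma tgamma_gt0 a : 0 < a -> (0 < tgamma a)%E.
Proof.
move=> a0; pose m := expR (-2) / 2 : R.
have m0 : 0 < m by rewrite divr_gt0 ?expR_gt0.
apply: (@lt_le_trans _ _ (\int[mu]_(x in `[1%R, 2%R]) (cst m x)%:E)%E).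
  rewrite (_ : (\int[mu]_(x in _) _)%E = m%:E * mu `[1%R, 2%R])%E; last first.
    have m12 : measurable (`[1%R, 2%R] : set R) by exact: measurable_itv.
    exact: (integral_cst mu m12 m%:E).
  rewrite lebesgue_measure_itv/= lte_fin ltr1n -EFinB -EFinM lte_fin mulr_gt0//; lra.
have mt : measurable_fun [set: R] (fun x => (tker 1 a x)%:E).
  by apply/measurable_EFinP; exact: measurable_tker.
apply: (@le_trans _ _ (\int[mu]_(x in `[1%R, 2%R]) (tker 1 a x)%:E)%E); last first.
  by apply: ge0_subset_integral => //= x _; rewrite lee_fin tker_ge0.
apply: ge0_le_integral => //=.
- by move=> x _; rewrite lee_fin ltW.
- exact: measurable_funTS.
move=> x; rewrite in_itv/= => /andP[x1 x2]; rewrite lee_fin /tker ifT ?(lt_le_trans _ x1)//.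
rewrite /m mulrC ler_pM ?invr_ge0 ?expR_ge0//; last by rewrite ler_expR mulN1r lerN2.
rewrite (@le_trans _ _ (x `^ (-1)))//; last by rewrite ler_powR//; lra.
by rewrite powR_inv1 ?(le_trans _ x1)// lef_pV2 ?posrE// (lt_le_trans _ x1).
Qed.

(** On ]0, 1] the integrand is at most x^(a-1); beyond 1, half of the exponent absorbs the power,
    leaving a multiple of the exponential density of rate 1/2. *)
Lemma tgamma_fin a : 0 < a -> (tgamma a < +oo)%E.
Proof.
move=> a0; have [n an] : exists n : nat, a <= n%:R.
  by exists (Num.truncn a).+1; rewrite ltW// truncnS_gt.
(* From (x/2)^(n+1) / (n+1)! <= exp(x/2); the leading 2 cancels the normalization 1/2 of the
   density. *)
pose C : R := 2 * (n.+1`!%:R * 2 ^+ n.+1).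
pose f x := ((fun y : R => y `^ (a - 1)) \_ `]0, 1]) x.
pose g x := C * exponential_pdf (2^-1 : R) x.
have f0 x : 0 <= f x by rewrite /f patchE; case: ifP => // _; exact: powR_ge0.
have C0 : 0 <= C by rewrite /C !mulr_ge0// exprn_ge0.
have p0 x : 0 <= exponential_pdf (2^-1 : R) x by exact: exponential_pdf_ge0.
have g0 x : 0 <= g x by rewrite /g mulr_ge0.
have mf : measurable_fun [set: R] f.
  by apply/(measurable_restrictT _ _).1 => //; apply: measurable_funTS; exact: measurable_powR.
have mp : measurable_fun [set: R] (exponential_pdf (2^-1 : R)) by exact: measurable_exponential_pdf.
have mg : measurable_fun [set: R] g by apply: measurable_funM => //; exact: measurable_cst.
apply: (@le_lt_trans _ _ (\int[mu]_x ((f x)%:E + (g x)%:E))%E).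
  apply: ge0_le_integral => //=.
  - by move=> x _; rewrite lee_fin tker_ge0.
  - by apply/measurable_EFinP; exact: measurable_tker.
  - by apply/measurable_EFinP; apply: measurable_funD.
  move=> x _; rewrite -EFinD lee_fin /tker; case: ifP => x0; last by rewrite addr_ge0.
  have [x1|x1] := leP x 1.
    rewrite -[leLHS]addr0 lerD// /f patchE ifT; last by rewrite inE/= in_itv/= x0.
    by rewrite ler_piMr ?powR_ge0// mulN1r -[leRHS]expR0 ler_expR oppr_le0 ltW.
  rewrite -[leLHS]add0r lerD// /g exponential_pdfE ?(ltW x0)//.
  have -> : expR (-1 * x) = expR (- 2^-1 * x) * expR (- 2^-1 * x) by rewrite -expRD; congr expR; lra.
  rewrite !mulrA ler_wpM2r ?expR_ge0// /C mulrAC divff// mul1r.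
  have -> : expR (- 2^-1 * x) = (expR (x / 2))^-1 by rewrite -expRN; congr expR; lra.
  rewrite ler_pdivrMr ?expR_gt0// (@le_trans _ _ (x ^+ n.+1))//.
    rewrite -powR_mulrn ?(ltW x0)// ler_powR ?(ltW x1)//.
    by rewrite -natr1; lra.
  have := @expR_ge1Dxn R (x / 2) n ltac:(by rewrite divr_ge0 ?ltW).
  rewrite expr_div_n => H; rewrite -ler_pdivrMl ?mulr_gt0 ?exprn_gt0 ?ltr0n ?fact_gt0//.
  by rewrite invfM mulrC mulrA mulrAC; apply: le_trans H; rewrite lerDr.
rewrite ge0_integralD//; last 4 first.
- by move=> x _; rewrite lee_fin.
- exact/measurable_EFinP.
- by move=> x _; rewrite lee_fin.
- exact/measurable_EFinP.
apply: lte_add_pinfty.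
  rewrite (_ : (\int[mu]_x _)%E = (\int[mu]_(x in `]0%R, 1%R]) (x `^ (a - 1))%R%:E)%E).
    by rewrite integral_powR_itv// ltry.
  by rewrite [RHS]integral_mkcond; apply: eq_integral => x _; rewrite restrict_EFin.
under eq_integral do rewrite EFinM.
rewrite ge0_integralZl//; last 2 first.
- exact/measurable_EFinP.
- by move=> x _; rewrite lee_fin.
by rewrite integral_exponential_pdf// mule1 ltry.
Qed.

Lemma Gamma_tgamma a : 0 < a -> (Gamma a)%:E = tgamma a.
Proof.
move=> a0; rewrite /Gamma /Rintegral -tgammaE fineK//.
by rewrite ge0_fin_numE ?tgamma_fin ?ltW ?tgamma_gt0.
Qed.

Lemma Gamma_gt0 a : 0 < a -> 0 < Gamma a.
Proof. by move=> a0; rewrite -lte_fin Gamma_tgamma// tgamma_gt0. Qed.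

Lemma Gamma1 : Gamma 1 = 1 :> R.
Proof. by apply: EFin_inj; rewrite Gamma_tgamma// tgamma1. Qed.

Lemma tbetaE a c : 0 < a -> 0 < c -> tbeta a c = (Gamma a * Gamma c / Gamma (a + c))%:E.
Proof.
move=> a0 c0; have ac0 : 0 < a + c by rewrite addr_gt0.
rewrite EFinM EFinM !Gamma_tgamma// tgammaM -Gamma_tgamma// -muleA -EFinM.
by rewrite divff ?mule1// gt_eqF// Gamma_gt0.
Qed.

(** Read off from B(a, 1) = 1 / a and Gamma(1) = 1, instead of an integration by parts. *)
Lemma GammaD1 a : 0 < a -> Gamma (a + 1) = a * Gamma a.
Proof.
move=> a0; have := tbetaE a0 ltr01; rewrite tbetar1// Gamma1 mulr1 => -[].
have a10 : Gamma (a + 1) != 0 by rewrite gt_eqF// Gamma_gt0// addr_gt0.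
move=> E; have <- : a^-1 * Gamma (a + 1) = Gamma a by rewrite E divfK.
by rewrite mulrA divff ?mul1r// gt_eqF.
Qed.

End GammaBeta.

(** * Convolution with the tempered kernel *)

Section ConvolutionOperator.
Context {R : realType}.
Notation mu := (@lebesgue_measure R).
Variable lam : R.
Implicit Types (a c x w X : R) (Y : R -> R).

Definition ker a x : R := tker lam a x / Gamma a.

Definition conv_int a Y X : R := \int[mu]_(x in `[0, X]) (ker a x * Y (X - x)).

Lemma ker_ge0 a x : 0 < a -> 0 <= ker a x.
Proof. by move=> a0; rewrite divr_ge0 ?tker_ge0// ltW// Gamma_gt0. Qed.

Lemma ker_le0 a x : x <= 0 -> ker a x = 0.
Proof. by move=> x0; rewrite /ker /tker ltNge x0 mul0r. Qed.

Lemma measurable_ker a : measurable_fun [set: R] (ker a).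
Proof. by apply: measurable_funM; [exact: measurable_tker|exact: measurable_cst]. Qed.

Lemma ker_convol a c w : 0 < a -> 0 < c ->
  (\int[mu]_x (ker a x * ker c (w - x))%R%:E = (ker (a + c) w)%:E)%E.
Proof.
move=> a0 c0.
have G0 : 0 <= (Gamma a)^-1 * (Gamma c)^-1 by rewrite mulr_ge0// invr_ge0 ltW// Gamma_gt0.
transitivity (\int[mu]_x (((Gamma a)^-1 * (Gamma c)^-1)%R%:E *
     (tker lam a x * tker lam c (w - x))%R%:E))%E.
  by apply: eq_integral => x _; rewrite -EFinM /ker; congr (_%:E); move: (Gamma a)^-1 (Gamma c)^-1 => ? ?; rewrite mulrACA mulrC.
rewrite ge0_integralZl//; last 2 first.
- by apply/measurable_EFinP; exact: measurable_tker_convol.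
- by move=> x _; rewrite lee_fin mulr_ge0 ?tker_ge0.
rewrite tker_convol tbetaE// -!EFinM; congr (_%:E); rewrite /ker.
have := Gamma_gt0 a0; have := Gamma_gt0 c0; have := Gamma_gt0 (addr_gt0 a0 c0).
move: (Gamma a) (Gamma c) (Gamma (a + c)) (tker _ _ _) => ga gc gac k ? ? ?.
by field; rewrite !gt_eqF.
Qed.

Lemma continuous_itv_bounded Y (u v : R) : continuous Y ->
  exists2 M, 0 <= M & forall x, u <= x <= v -> `|Y x| <= M.
Proof.
move=> cY; have [uv|vu] := leP u v; last first.
  by exists 0 => // x /andP[ux /(le_trans ux)]; rewrite leNgt vu.
have cY' : {within `[u, v], continuous (fun x => `|Y x|)}.
  apply: continuous_subspaceT => x; apply: continuous_comp; first exact: cY.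
  exact: norm_continuous.
have [c cuv Hc] := EVT_max uv cY'.
by exists `|Y c| => // x xuv; apply: Hc; rewrite in_itv.
Qed.

(** On ]0, X] the exponential is at most exp(|lam| X), which leaves the integrable power x^(a-1);
    elsewhere to the left the kernel vanishes. *)
Lemma integrable_ker a (u v : R) : 0 < a -> mu.-integrable `[u, v] (EFin \o ker a).
Proof.
move=> a0; pose X := Num.max v 1.
have X0 : 0 < X by rewrite lt_max ltr01 orbT.
apply: (@integrableS _ _ _ mu `]-oo, X]) => //=.
  by move=> x /=; rewrite !in_itv/= => /andP[_ xv]; rewrite le_max xv.
pose C := expR (`|lam| * X) / Gamma a.
have C0 : 0 <= C by rewrite divr_ge0 ?expR_ge0// ltW// Gamma_gt0.
pose p x : R := C * x `^ (a - 1).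
pose g := p \_ `]0, X].
have mp : measurable_fun [set: R] p.
  by apply: measurable_funM; [exact: measurable_cst|exact: measurable_powR].
have mg : measurable_fun [set: R] g.
  by apply/(measurable_restrictT _ _).1 => //; exact: measurable_funTS.
have p0 x : 0 <= p x by rewrite mulr_ge0// powR_ge0.
have mpow : measurable_fun [set: R] (fun x : R => (x `^ (a - 1))%:E).
  by apply/measurable_EFinP; exact: measurable_powR.
have ig : mu.-integrable `]-oo, X] (EFin \o g).
  apply/integrableP; split.
    by apply: measurable_funTS; exact/measurable_EFinP.
  apply: (@le_lt_trans _ _ (\int[mu]_x `|(g x)%:E|)%E).
    apply: ge0_subset_integral => //=.
    by apply/measurable_EFinP; exact: measurableT_comp.
  rewrite (_ : (\int[mu]_x _)%E = (\int[mu]_(x in `]0%R, X]) (C%:E * (x `^ (a - 1))%R%:E))%E).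
    rewrite ge0_integralZl//; last 2 first.
    - exact: measurable_funTS.
    - by move=> x _; rewrite lee_fin powR_ge0.
    by rewrite integral_powR_itv// -EFinM ltry.
  rewrite [RHS]integral_mkcond; apply: eq_integral => x _.
  rewrite /g !patchE; case: ifPn => _ /=; last by rewrite normr0.
  by rewrite ger0_norm// p0.
apply: le_integrable ig => //.
  by apply: measurable_funTS; apply/measurable_EFinP; exact: measurable_ker.
move=> x /=; rewrite in_itv/= => xX; rewrite lee_fin.
rewrite ger0_norm ?ker_ge0//; apply: le_trans (ler_norm _).
have [x0|x0] := leP x 0.
  by rewrite ker_le0// /g patchE; case: ifP => _ //; exact: p0.
rewrite /g patchE ifT; last by rewrite inE/= in_itv/= x0.
rewrite /ker /tker x0 /p /C -mulrA [leRHS]mulrC ler_wpM2l ?powR_ge0//.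
rewrite ler_wpM2r ?invr_ge0 ?(ltW (Gamma_gt0 _))// ler_expR (le_trans (ler_norm _))//.
by rewrite normrM normrN ler_wpM2l// gtr0_norm.
Qed.

Lemma integrable_kerM a (h : R -> R) (u v : R) : 0 < a -> continuous h ->
  mu.-integrable `[u, v] (EFin \o (fun x => ker a x * h x)).
Proof.
move=> a0 ch; have [M M0 HM] := @continuous_itv_bounded h u v ch.
have iM : mu.-integrable `[u, v] (fun x => M%:E * (EFin \o ker a) x)%E.
  by apply: integrableZl => //; exact: integrable_ker.
apply: le_integrable iM => //.
  apply: measurable_funTS; apply/measurable_EFinP; apply: measurable_funM.
    exact: measurable_ker.
  exact: continuous_measurable_fun.
move=> x /=; rewrite in_itv/= => xuv; rewrite lee_fin !normrM.
by rewrite mulrC ler_wpM2r// (le_trans _ (ler_norm _))// HM.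
Qed.

Lemma continuous_reflect Y X : continuous Y -> continuous (fun x => Y (X - x)).
Proof.
move=> cY x; apply: continuous_comp; last exact: cY.
by apply: cvgB; [exact: cvg_cst|exact: cvg_id].
Qed.

Lemma integrable_conv_int a Y X : 0 < a -> continuous Y ->
  mu.-integrable `[0, X] (EFin \o (fun x => ker a x * Y (X - x))).
Proof. by move=> a0 cY; apply: integrable_kerM => //; exact: continuous_reflect. Qed.

Lemma conv_int_lt0 a Y X : X < 0 -> conv_int a Y X = 0.
Proof. by move=> X0; rewrite /conv_int set_itv_ge ?Rintegral_set0// bnd_simp -ltNge. Qed.

(** Puts the convolution on the whole line, with Y cut off at negative arguments: the form to which
    [ge0_convolutionA] applies. *)
Lemma conv_intE a Y X : 0 < a -> continuous Y ->
  ((conv_int a Y X)%:E = \int[mu]_x (ker a x * (if 0 <= X - x then Y (X - x) else 0))%R%:E)%E.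
Proof.
move=> a0 cY; rewrite /conv_int /Rintegral fineK; last first.
  by apply: integrable_fin_num => //; exact: integrable_conv_int.
rewrite integral_mkcond; apply: eq_integral => x _; rewrite patchE subr_ge0.
case: ifPn; rewrite ?inE ?notin_setE/= in_itv/=; first by move=> /andP[_ ->].
move=> /negP; rewrite negb_and -!ltNge => /orP[x0|xX]; first by rewrite ker_le0 ?mul0r// ltW.
by rewrite leNgt xX/= mulr0.
Qed.

Lemma conv_intB a Y1 Y2 X : 0 < a -> continuous Y1 -> continuous Y2 ->
  conv_int a (fun x => Y1 x - Y2 x) X = conv_int a Y1 X - conv_int a Y2 X.
Proof.
move=> a0 c1 c2; rewrite -RintegralB//; try exact: integrable_conv_int.
by apply: eq_Rintegral => x _; rewrite mulrBr.
Qed.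

Lemma conv_intZ a (r : R) Y X : 0 < a -> continuous Y ->
  conv_int a (fun x => r * Y x) X = r * conv_int a Y X.
Proof.
move=> a0 cY; rewrite -RintegralZl//; last exact: integrable_conv_int.
by apply: eq_Rintegral => x _; rewrite mulrCA.
Qed.

Lemma eq_conv_int a Y1 Y2 X : (forall x, 0 <= x <= X -> Y1 x = Y2 x) ->
  conv_int a Y1 X = conv_int a Y2 X.
Proof.
move=> Y12; apply: eq_Rintegral => x; rewrite inE/= in_itv/= => /andP[x0 xX].
by rewrite Y12// subr_ge0 xX/= gerBl.
Qed.

(** X occurs both in the domain and in the integrand. Splitting off the constant Y 0 separates the
    two: the rest vanishes at 0 and extends continuously by 0, so its domain can be fixed and
    dominated convergence applies; the constant leaves the integral of [ker] with variable upper
    limit. *)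
Lemma continuous_conv_int a Y : 0 < a -> continuous Y -> continuous (conv_int a Y).
Proof.
move=> a0 cY X0.
(* A window around both X0 and 0, so that X0 is interior and the singularity of the kernel at 0 lies
   inside. *)
pose A := Num.min X0 0 - 1; pose L := Num.max X0 0 + 1.
have AX : A < X0 by rewrite ltrBlDr (@le_lt_trans _ _ X0) ?ltrDl// ge_min lexx.
have XL : X0 < L by rewrite (@le_lt_trans _ _ (Num.max X0 0)) ?ltrDl// le_max lexx.
have A0 : A < 0 by rewrite ltrBlDr add0r (@le_lt_trans _ _ 0)// ge_min lexx orbT.
have L0 : 0 < L by rewrite ltr_wpDl// le_max lexx orbT.
pose Z x := Y (Num.max x 0) - Y 0.
have cZ : continuous Z.
  move=> x; apply: cvgB; last exact: cvg_cst.
  apply: continuous_comp; last exact: cY.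
  by apply: continuous_max; [exact: cvg_id|exact: cvg_cst].
have Z0 x : x <= 0 -> Z x = 0 by move=> x0; rewrite /Z max_r// subrr.
pose F1 X := \int[mu]_(x in `[0, L]) (ker a x * Z (X - x)).
pose F2 X := \int[mu]_(x in `[A, X]) ker a x.
have E X : A < X -> X < L -> conv_int a Y X = F1 X + Y 0 * F2 X.
  move=> AX' XL'; have iT (u v : R) (h : R -> R) : mu.-integrable `[u, v] (EFin \o h) ->
      mu.-integrable setT (EFin \o (h \_ `[u, v])).
    by move=> ih; rewrite -restrict_EFin; apply/integrable_restrict => //; rewrite setTI.
  rewrite /F1 /F2 -RintegralZl//; last exact: integrable_ker.
  rewrite [LHS]Rintegral_mkcond [X in _ = X + _]Rintegral_mkcond.
  rewrite [X in _ = _ + X]Rintegral_mkcond -RintegralD//; last 2 first.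
  - by apply: iT; apply: integrable_kerM => //; exact: continuous_reflect.
  - apply: iT; rewrite (_ : EFin \o _ = fun x => ((Y 0)%:E * (EFin \o ker a) x)%E); last first.
      by apply/funext => x; rewrite /= EFinM.
    by apply: integrableZl => //; exact: integrable_ker.
  apply: eq_Rintegral => x _; rewrite !patchE.
  have [x0|x0] := leP x 0; first by rewrite ker_le0// !mul0r mulr0 !if_same addr0.
  have m1 : (x \in [set` `[0, X]]) = (x <= X) by rewrite mem_setE in_itv/= ltW.
  have m2 : (x \in [set` `[0, L]]) = (x <= L) by rewrite mem_setE in_itv/= ltW.
  have m3 : (x \in [set` `[A, X]]) = (x <= X) by rewrite mem_setE in_itv/= (ltW (lt_trans A0 x0)).
  rewrite m1 m2 m3; have [xX|Xx] := leP x X.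
    rewrite (le_trans xX (ltW XL')) /Z max_l ?subr_ge0//; ring.
  by rewrite addr0; case: ifP => // _; rewrite Z0 ?mulr0// subr_le0 ltW.
have cF1 : {for X0, continuous F1}.
  have [M M0 HM] := @continuous_itv_bounded Z (A - L) L cZ.
  have iM : mu.-integrable `[0, L] (EFin \o (fun x => M * ker a x)).
    rewrite (_ : EFin \o _ = fun x => (M%:E * (EFin \o ker a) x)%E); last first.
      by apply/funext => x; rewrite /= EFinM.
    by apply: integrableZl => //; exact: integrable_ker.
  apply: (@continuity_under_integral R _ _ mu (fun X x => ker a x * Z (X - x)) `[0, L]
    (measurable_itv _) A L _ _ (fun x => M * ker a x)) => //.
  - by move=> X _; apply: integrable_kerM => //; exact: continuous_reflect.
  - apply: aeW => x _ X _; apply: cvgM; first exact: cvg_cst.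
    apply: continuous_cvg; first exact: cZ.
    by apply: cvgB; [exact: cvg_id|exact: cvg_cst].
  - move=> X; rewrite /= in_itv/= => /andP[AX' XL']; apply: aeW => x /=.
    rewrite in_itv/= => /andP[x0 xL]; rewrite normrM ger0_norm ?ker_ge0// mulrC.
    rewrite ler_wpM2r ?ker_ge0// HM//; apply/andP; split; first by rewrite lerB// ltW.
    by rewrite lerBlDr (le_trans (ltW XL'))// lerDl.
  - by rewrite mem_setE in_itv/= AX.
have cF2 : {for X0, continuous F2}.
  have : {within `[A, L], continuous F2}.
    apply: parameterized_integral_continuous; last exact: integrable_ker.
    by rewrite ltW// (lt_trans AX).
  move=> /(continuous_within_itvP _ (lt_trans AX XL))[+ _ _]; apply.
  by rewrite in_itv/= AX.
have : F1 X + Y 0 * F2 X @[X --> X0] --> conv_int a Y X0.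
  by rewrite E//; apply: cvgD => //; apply: cvgM => //; exact: cvg_cst.
apply: cvg_trans; apply: near_eq_cvg; near=> X; rewrite E//; near: X.
  exact: lt_nbhsr.
exact: lt_nbhsl.
Unshelve. all: by end_near. Qed.

(** Tonelli's theorem needs Y >= 0; positive and negative parts, both continuous, reduce to that
    case, where associativity of convolution and [ker_convol] conclude. *)
Lemma conv_intA a c Y X : 0 < a -> 0 < c -> continuous Y ->
  conv_int a (conv_int c Y) X = conv_int (a + c) Y X.
Proof.
move=> a0 c0.
wlog Y0 : Y / forall x, 0 <= Y x => [H cY|].
  pose Y1 x := Num.max (Y x) 0; pose Y2 x := Num.max (- Y x) 0.
  have Y10 x : 0 <= Y1 x by rewrite le_max lexx orbT.
  have Y20 x : 0 <= Y2 x by rewrite le_max lexx orbT.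
  have cY1 : continuous Y1.
    by move=> x; apply: (@continuous_max _ _ Y (cst 0)); [exact: cY|exact: cvg_cst].
  have cY2 : continuous Y2.
    move=> x; apply: (@continuous_max _ _ (fun z => - Y z) (cst 0)); last exact: cvg_cst.
    by apply: continuousN; exact: cY.
  have -> : Y = (fun x => Y1 x - Y2 x).
    apply/funext => x; rewrite /Y1 /Y2; have [y0|y0] := leP 0 (Y x).
      by rewrite max_r ?subr0// oppr_le0.
    by rewrite max_l ?oppr_ge0 ?(ltW y0)// sub0r opprK.
  have -> : conv_int c (fun x => Y1 x - Y2 x) = (fun x => conv_int c Y1 x - conv_int c Y2 x).
    by apply/funext => x; exact: conv_intB.
  rewrite !conv_intB ?H//; try exact: continuous_conv_int.
  exact: addr_gt0.
move=> cY; apply: EFin_inj.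
have cJ : continuous (conv_int c Y) by exact: continuous_conv_int.
pose h z := if 0 <= z then Y z else 0.
have h0 z : 0 <= h z by rewrite /h; case: ifP.
have mh : measurable_fun [set: R] h.
  apply: measurable_fun_ifT => //=.
  - by apply: measurable_fun_ler => //; exact: measurable_cst.
  - exact: continuous_measurable_fun.
rewrite !conv_intE ?addr_gt0//.
have := @ge0_convolutionA R (ker a) (ker c) h X (fun x => ker_ge0 x a0) (fun x => ker_ge0 x c0)
  h0 (measurable_ker a) (measurable_ker c) mh.
under eq_integral do rewrite -conv_intE//.
under [RHS]eq_integral do rewrite ker_convol// -EFinM.
move=> <-; apply: eq_integral => x _; rewrite -EFinM.
by case: ifPn => //; rewrite -ltNge => Xx; rewrite conv_int_lt0.
Qed.

End ConvolutionOperator.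

(** * Substitution along a strictly increasing function whose derivative may vanish *)

Section SubstitutionIncreasing.
Context {R : realType}.
Notation mu := (@lebesgue_measure R).
Variables (P p : R -> R) (t : R).
Hypotheses (t0 : 0 <= t) (cP : continuous P) (cp : continuous p).
Hypotheses (p0 : forall s, 0 <= p s).
Hypothesis Pmono : forall x y, 0 <= x -> x < y -> y <= t -> P x < P y.
Hypothesis FTC : forall s, 0 <= s <= t ->
  (\int[mu]_(x in `[0%R, s]) (p x)%:E = (P s - P 0)%:E)%E.

Let Ple x y : 0 <= x -> x <= y -> y <= t -> P x <= P y.
Proof.
by move=> x0; rewrite le_eqVlt => /predU1P[->//|xy] yt; rewrite ltW// Pmono.
Qed.

Let mT : measurable_fun [set: R] (fun s => P t - P s).
Proof.
by apply: measurable_funB; [exact: measurable_cst|exact: continuous_measurable_fun].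
Qed.

(** For v in ]0, P t - P 0] the preimage of the ray is an initial segment [0, s0] with P s0 = P t -
    v, by the intermediate value theorem and strict monotonicity, and [FTC] evaluates the weight
    there. For smaller v it is all of [0, t], for larger v it is empty. *)
Let rayE (v : R) : (\int[mu]_(x in `[0%R, t] `&` (fun s => P t - P s)%R @^-1` `[v, +oo[) (p x)%:E =
  mu (`[0%R, (P t - P 0)%R] `&` `[v, +oo[))%E.
Proof.
have X0 : 0 <= P t - P 0 by rewrite subr_ge0 Ple.
rewrite (lebesgue_measure_itvcc_Icy _ X0).
have [v0|v0] := leP v 0.
  rewrite (_ : `[0, t] `&` _ = `[0, t]%classic); last first.
    apply/seteqP; split => x /=; rewrite !in_itv/= andbT; first by case.
    move=> /[dup] /andP[x0 xt] ->; split => //.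
    by rewrite (le_trans v0)// subr_ge0 Ple.
  by rewrite FTC ?t0 ?lexx// subr0 (max_r X0).
have [vX|vX] := ltP (P t - P 0) v.
  rewrite (_ : `[0, t] `&` _ = set0); last first.
    apply/seteqP; split => x //=; rewrite !in_itv/= andbT => -[/andP[x0 xt]].
    apply/negP; rewrite -ltNge (le_lt_trans _ vX)// lerB//.
    exact: Ple.
  by rewrite integral_set0 max_l// subr_le0 ltW.
have [s0 s0t Ps0] : exists2 s0, s0 \in `[0, t] & P s0 = P t - v.
  apply: IVT => //; first exact: continuous_subspaceT.
  rewrite (@min_l _ _ (P 0)) ?(@max_r _ _ (P 0)) ?Ple//.
  by rewrite gerBl (ltW v0) andbT lerBrDr -lerBrDl.
move: s0t; rewrite in_itv/= => /andP[s00 s0t].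
rewrite (_ : `[0, t] `&` _ = `[0, s0]%classic); last first.
  apply/seteqP; split => x /=; rewrite !in_itv/= andbT.
    move=> [/andP[x0 xt]]; rewrite x0/= lerBrDr addrC -lerBrDr -Ps0 => PxP.
    by rewrite leNgt; apply/negP => /(Pmono s00)/(_ xt); rewrite ltNge PxP.
  move=> /andP[x0 xs]; rewrite x0 (le_trans xs)//; split => //.
  by rewrite lerBrDr addrC -lerBrDr -Ps0 Ple.
by rewrite FTC ?s00// Ps0 max_r; [congr (_%:E); ring|rewrite subr_ge0].
Qed.

Lemma ge0_integral_subst_increasing (k : R -> \bar R) :
  (forall x, 0 <= k x)%E -> measurable_fun setT k ->
  (\int[mu]_(s in `[0%R, t]) ((p s)%:E * k (P t - P s)%R) =
   \int[mu]_(x in `[0%R, (P t - P 0)%R]) k x)%E.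
Proof.
move=> k0 mk.
have Xfin : (mu `[0%R, (P t - P 0)%R] < +oo)%E.
  by rewrite lebesgue_measure_itv/=; case: ifPn => // _; rewrite -EFinB ltry.
exact: (@ge0_integral_subst R `[0, t] `[0, P t - P 0] (fun s => P t - P s) p
  (measurable_itv _) (measurable_itv _) mT (continuous_measurable_fun cp) p0 rayE Xfin).
Qed.

(** Positive and negative parts are compared separately, so the identity holds in [\bar R] before
    integrability is known; applied to the absolute value of k it will yield integrability. *)
Lemma integral_subst_increasing (k : R -> R) : measurable_fun setT k ->
  (\int[mu]_(s in `[0%R, t]) (p s * k (P t - P s))%R%:E =
   \int[mu]_(x in `[0%R, (P t - P 0)%R]) (k x)%:E)%E.
Proof.
move=> mk; rewrite [LHS]integralE [RHS]integralE.
have mk' : measurable_fun [set: R] (EFin \o k) by exact/measurable_EFinP.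
rewrite -(@ge0_integral_subst_increasing (fun x => (EFin \o k)^\+ x)%E)//; last 1 first.
  exact: measurable_funepos.
rewrite -(@ge0_integral_subst_increasing (fun x => (EFin \o k)^\- x)%E)//; last 1 first.
  exact: measurable_funeneg.
congr (_ - _)%E; apply: eq_integral => s _.
- by rewrite !funeposE/= EFinM maxe_pMr ?lee_fin// mule0.
- by rewrite !funenegE/= -mulrN EFinM maxe_pMr ?lee_fin// mule0.
Qed.

End SubstitutionIncreasing.

Lemma is_derive_expRM {R : realType} (r x : R) :
  is_derive x 1 (fun x : R => expR (r * x)) (r * expR (r * x)).
Proof.
have dM : is_derive x (1 : R) (fun x : R => r * x) r.
  by have := @is_deriveZ R R R id r x 1 1 _; rewrite /GRing.scale/= mulr1; exact.
by rewrite mulrC; exact: (is_derive1_comp (is_derive_expR (r * x)) dM).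
Qed.

(** * Convolution of order one, and raising the order by one *)

Section OrderOne.
Context {R : realType}.
Notation mu := (@lebesgue_measure R).
Variable lam : R.
Implicit Types (q x X : R) (Y : R -> R).

Lemma continuous_expRM : continuous (fun x : R => expR (lam * x)).
Proof.
move=> x; apply: continuous_comp; last exact: continuous_expR.
by apply: cvgM; [exact: cvg_cst|exact: cvg_id].
Qed.

Lemma ker1_gt0 x : 0 < x -> ker lam 1 x = expR (- lam * x).
Proof. by move=> x0; rewrite /ker /tker x0 Gamma1 divr1 subrr powRr0 mul1r. Qed.

Lemma integral_reflect (k : R -> R) X : 0 <= X -> measurable_fun setT k ->
  (\int[mu]_(s in `[0%R, X]) (k (X - s))%:E = \int[mu]_(x in `[0%R, X]) (k x)%:E)%E.
Proof.
move=> X0 mk.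
have cid : continuous (id : R -> R) by move=> ?; exact: cvg_id.
have c1 : continuous (cst 1 : R -> R) by move=> ?; exact: cvg_cst.
have FTC1 s : 0 <= s <= X -> (\int[mu]_(x in `[0%R, s]) (cst 1%R x)%:E = (s - 0)%:E)%E.
  move=> /andP[s0 _]; rewrite (_ : (\int[mu]_(x in _) _)%E = 1%E * mu `[0%R, s])%E; last first.
    exact: (integral_cst mu (measurable_itv _) 1%E).
  rewrite mul1e lebesgue_measure_itv/= lte_fin; case: ltP => // s0'.
  by rewrite (le_anti (introT andP (conj s0 s0'))) subrr.
have := @integral_subst_increasing R id (cst 1) X X0 cid c1 (fun=> ler01)
  (fun x y _ xy _ => xy) FTC1 k mk.
by rewrite subr0 => <-; apply: eq_integral => s _; rewrite mul1r.
Qed.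

(** At order one the kernel is a pure exponential, so after reflection the dependence on X factors
    out of the integral. *)
Lemma conv_int1E Y X : 0 <= X -> continuous Y ->
  conv_int lam 1 Y X = expR (- lam * X) * \int[mu]_(v in `[0, X]) (expR (lam * v) * Y v).
Proof.
move=> X0 cY; have cg : continuous (fun v => expR (lam * v) * Y v).
  by move=> x; apply: cvgM; [exact: continuous_expRM|exact: cY].
have ig : mu.-integrable `[0, X] (EFin \o (fun v => expR (lam * v) * Y v)).
  apply: continuous_compact_integrable; first exact: segment_compact.
  exact: continuous_subspaceT.
rewrite -RintegralZl// /conv_int /Rintegral; congr fine.
pose k x := expR (- lam * x) * Y (X - x).
have mk : measurable_fun [set: R] k.
  apply: measurable_funM; last by apply: continuous_measurable_fun; exact: continuous_reflect.
  apply: (measurableT_comp (@measurable_expR R)).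
  by apply: measurable_funM => //; exact: measurable_cst.
transitivity (\int[mu]_(x in `[0%R, X]) (k x)%:E)%E.
  (* The endpoint 0 is dropped because [ker] is 0 there while the exponential is 1. *)
  rewrite -[LHS]integral_itv_obnd_cbnd; last first.
    apply: measurable_funTS; apply/measurable_EFinP; apply: measurable_funM.
      exact: measurable_ker.
    by apply: continuous_measurable_fun; exact: continuous_reflect.
  rewrite -[RHS]integral_itv_obnd_cbnd; last first.
    by apply: measurable_funTS; exact/measurable_EFinP.
  apply: eq_integral => x; rewrite inE/= in_itv/= => /andP[x0 _].
  by rewrite ker1_gt0.
rewrite -integral_reflect//; apply: eq_integral => s _; congr (_%:E).
rewrite /k mulrA -expRD; congr (expR _ * Y _); ring.
Qed.

(** [conv_int] is 0 for negative arguments, so at 0 it has in general a corner. Integrating from -1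
    gives an extension H that is differentiable on both sides of 0, as the chain rule [wquot_comp]
    requires at t = 0. *)
Lemma conv_int1_primitive Y : continuous Y ->
  exists H : R -> R, (forall X, 0 <= X -> H X = conv_int lam 1 Y X) /\
    forall X, 0 <= X -> is_derive X 1 H (Y X - lam * H X).
Proof.
move=> cY; pose g v := expR (lam * v) * Y v.
have cg : continuous g.
  by move=> x; apply: cvgM; [exact: continuous_expRM|exact: cY].
have ig (u v : R) : mu.-integrable `[u, v] (EFin \o g).
  apply: continuous_compact_integrable; first exact: segment_compact.
  exact: continuous_subspaceT.
pose A X := \int[mu]_(v in `[-1, X]) g v.
pose H X := expR (- lam * X) * (A X - A 0).
have dA X : 0 <= X -> is_derive X 1 A (g X).
  move=> X0; have X1 : X < X + 1 by rewrite ltrDl.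
  have NX : -1 < X by rewrite (lt_le_trans _ X0)// oppr_lt0.
  have [dAX AX] := @continuous_FTC1_closed R g (-1) X (X + 1) X1 (ig _ _) NX (@cg X).
  by split; [exact: dAX|rewrite -derive1E; exact: AX].
exists H; split.
  move=> X X0; rewrite conv_int1E//; congr (_ * _); rewrite /A.
  rewrite (Rintegral_itvB (ig _ _)) ?bnd_simp ?lerN10//.
  rewrite Rintegral_itv_obnd_cbnd//; apply: integrableS (ig 0 X) => //.
  by apply: subset_itvr; rewrite bnd_simp.
move=> X X0; have dAX := dA X X0.
have dE := is_derive_expRM (- lam) X.
have dB : is_derive X 1 (fun x => A x - A 0) (g X).
  by rewrite -[g X]subr0; apply: is_deriveB.
have -> : Y X - lam * H X =
    expR (- lam * X) *: g X + (A X - A 0) *: (- lam * expR (- lam * X)).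
  have -> : Y X = expR (- lam * X) * g X.
    by rewrite /g mulrA -expRD mulNr addNr expR0 mul1r.
  rewrite /H /GRing.scale/=; ring.
exact: is_deriveM.
Qed.

Lemma conv_int_le0 q Y X : X <= 0 -> conv_int lam q Y X = 0.
Proof.
rewrite le_eqVlt => /predU1P[->|]; last exact: conv_int_lt0.
by rewrite /conv_int set_itv1 Rintegral_set1.
Qed.

(** The fundamental theorem for exp(lam v) on [0, x], multiplied by exp(-lam x). *)
Lemma conv_int11 x : 0 <= x -> 1 = expR (- lam * x) + lam * conv_int lam 1 (cst 1) x.
Proof.
rewrite le_eqVlt => /predU1P[<-|x0].
  by rewrite mulr0 expR0 conv_int_le0// mulr0 addr0.
have c1 : continuous (cst 1 : R -> R) by move=> ?; exact: cvg_cst.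
rewrite conv_int1E ?ltW//.
have cE : {within `[0, x], continuous (fun v => lam * expR (lam * v))}.
  by apply: continuous_subspaceT => v; apply: cvgM; [exact: cvg_cst|exact: continuous_expRM].
have dE v := is_derive_expRM lam v.
have LR : derivable_oo_LRcontinuous (fun v => expR (lam * v)) 0 x.
  split; first by move=> v _; exact: (@ex_derive _ _ _ _ _ _ _ (dE v)).
    by apply: cvg_at_right_filter; exact: continuous_expRM.
  by apply: cvg_at_left_filter; exact: continuous_expRM.
have dEf : {in `]0, x[, (fun v => expR (lam * v))^`()%classic =1 (fun v => lam * expR (lam * v))}.
  by move=> v _; rewrite derive1E (@derive_val _ _ _ _ _ _ _ (dE v)).
have := continuous_FTC2 x0 cE LR dEf.
rewrite mulr0 expR0 => /(congr1 fine) /= F.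
have : lam * \int[mu]_(v in `[0, x]) (expR (lam * v) * cst 1 v) = expR (lam * x) - 1.
  rewrite -[RHS]F -RintegralZl//; last first.
    apply: continuous_compact_integrable; first exact: segment_compact.
    by apply: continuous_subspaceT => v; apply: cvgM; [exact: continuous_expRM|exact: cvg_cst].
  by apply: eq_Rintegral => v _; rewrite /= mulr1.
rewrite mulrCA => ->; rewrite mulrBr -expRD mulNr addNr expR0 mulr1; ring.
Qed.

(** The exponentials combine to exp(-lam X), what remains is the integral X^q / q of a power, and q
    Gamma(q) = Gamma(q + 1). *)
Lemma conv_int_exp q X : 0 < q -> 0 <= X ->
  conv_int lam q (fun x => expR (- lam * x)) X = ker lam (q + 1) X.
Proof.
move=> q0; rewrite le_eqVlt => /predU1P[<-|X0].
  by rewrite conv_int_le0// ker_le0.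
rewrite /conv_int /Rintegral.
rewrite (_ : (\int[mu]_(x in `[0%R, X]) _)%E =
   \int[mu]_(x in `[0%R, X]) ((expR (- lam * X) / Gamma q)%R%:E * (if (0 < x)%R then (x `^ (q - 1))%R else 0%R)%:E))%E; last first.
  apply: eq_integral => x _; rewrite -EFinM; congr (_%:E); rewrite /ker /tker.
  case: ifP => _; last by rewrite !mul0r mulr0.
  have -> : expR (- lam * X) = expR (- lam * x) * expR (- lam * (X - x)).
    by rewrite -expRD; congr expR; ring.
  by move: (Gamma q)^-1 => ?; ring.
have mpow : measurable_fun [set: R] (fun x : R => (if 0 < x then x `^ (q - 1) else 0)%:E).
  apply/measurable_EFinP; apply: measurable_fun_ifT => //=.
  by apply: measurable_fun_ltr => //; exact: measurable_cst.
rewrite ge0_integralZl//; last 3 first.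
- exact: measurable_funTS.
- by move=> x _; rewrite lee_fin; case: ifP => // _; exact: powR_ge0.
- by rewrite lee_fin divr_ge0 ?expR_ge0// ltW// Gamma_gt0.
rewrite -integral_itv_obnd_cbnd; last exact: measurable_funTS.
have -> : (\int[mu]_(x in `]0%R, X]) (if (0 < x)%R then (x `^ (q - 1))%R else 0%R)%:E =
    (X `^ q / q)%R%:E)%E.
  rewrite -(integral_powR_itv q0 X0). apply: eq_integral => x.
  by rewrite inE/= in_itv/= => /andP[-> _].
rewrite -EFinM /= /ker /tker X0 GammaD1// addrK.
have := Gamma_gt0 q0; move: (Gamma q) => ga ga0.
by field; rewrite !gt_eqF.
Qed.

(** Convolve the identity [conv_int11] with K_q: the exponential gives K_(q+1), and the semigroup
    property merges the orders q and 1. *)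
Lemma conv_int_cst1 q X : 0 < q -> 0 <= X ->
  conv_int lam q (cst 1) X = ker lam (q + 1) X + lam * conv_int lam (q + 1) (cst 1) X.
Proof.
move=> q0 X0.
have c1 : continuous (cst 1 : R -> R) by move=> ?; exact: cvg_cst.
have cJ : continuous (conv_int lam 1 (cst 1)) by exact: continuous_conv_int.
have cE : continuous (fun x : R => expR (- lam * x)).
  move=> x; apply: continuous_comp; last exact: continuous_expR.
  by apply: cvgM; [exact: cvg_cst|exact: cvg_id].
rewrite -conv_intA// -conv_int_exp//.
have cN : continuous (fun x => - lam * conv_int lam 1 (cst 1) x).
  by move=> x; apply: cvgM; [exact: cvg_cst|exact: cJ].
rewrite -[lam * _]opprK -mulNr -conv_intZ// -conv_intB//.
by apply: eq_conv_int => x /andP[x0 _]; rewrite [X in _ - X]mulNr opprK -conv_int11.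
Qed.

End OrderOne.

(** * The Mittag-Leffler function *)

Section MittagLefflerExpansion.
Local Opaque conv_int Gamma.
Context {R : realType}.
Notation mu := (@lebesgue_measure R).
Variable lam : R.
Implicit Types q r X : R.

Lemma affine_recurrence (u k : nat -> R) N : (forall n, u n = k n + lam * u n.+1) ->
  u 0%N = \sum_(0 <= j < N) lam ^+ j * k j + lam ^+ N * u N.
Proof.
move=> uE; elim: N => [|N ->]; first by rewrite big_geq// add0r expr0 mul1r.
by rewrite big_nat_recr//= uE mulrDr addrA exprSr mulrA.
Qed.

(** The argument of [Gamma] is kept in the form p j + q of [mittag_leffler] with p = 1, so that the
    partial sums match literally. *)
Lemma ker_term q X j : 0 < X ->
  lam ^+ j * ker lam (q + j%:R + 1) X =
  expR (- lam * X) * X `^ q * ((lam * X) ^+ j / Gamma (1 * j%:R + (q + 1))).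
Proof.
move=> X0; rewrite mul1r addrCA addrA /ker /tker X0 addrK.
rewrite powRD ?(gt_eqF X0) ?implybT// powR_mulrn ?(ltW X0)// exprMn.
by move: (Gamma _)^-1 => g; ring.
Qed.

Lemma conv_int_cst1_partial q X N : 0 < q -> 0 < X ->
  conv_int lam q (cst 1) X =
  expR (- lam * X) * X `^ q *
    \sum_(0 <= j < N) (lam * X) ^+ j / Gamma (1 * j%:R + (q + 1))
  + lam ^+ N * conv_int lam (q + N%:R) (cst 1) X.
Proof.
move=> q0 X0; pose u n := conv_int lam (q + n%:R) (cst 1) X.
have uE n : u n = ker lam (q + n%:R + 1) X + lam * u n.+1.
  by rewrite /u -natr1 addrA; apply: conv_int_cst1; [rewrite ltr_pwDl|exact: ltW].
have := affine_recurrence N uE; rewrite {1}/u addr0 => ->; congr (_ + _).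
by rewrite big_distrr/=; apply: eq_bigr => j _; exact: ker_term.
Qed.

(** On [0, X] the constant 1 is at most exp(|lam| X) exp(-lam x), whose convolution is known exactly
    by [conv_int_exp]. *)
Lemma conv_int_cst1_le r X : 0 < r -> 0 < X ->
  `|conv_int lam r (cst 1) X| <= expR (`|lam| * X) * ker lam (r + 1) X.
Proof.
move=> r0 X0.
have c1 : continuous (cst 1 : R -> R) by move=> ?; exact: cvg_cst.
have cE := @continuous_expRM R (- lam).
have cE' : continuous (fun x => expR (`|lam| * X) * expR (- lam * x)).
  by move=> x; apply: cvgM; [exact: cvg_cst|exact: cE].
rewrite ger0_norm; last first.
  by apply: Rintegral_ge0 => x _; rewrite mulr1 ker_ge0.
rewrite -conv_int_exp ?(ltW X0)// -conv_intZ//.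
apply: le_Rintegral => //.
- exact: (integrable_conv_int _ _ r0 c1).
- exact: (integrable_conv_int _ _ r0 cE').
move=> x /=; rewrite in_itv/= => /andP[x0 xX]; rewrite ler_wpM2l ?ker_ge0//.
rewrite -expRD -[leLHS]expR0 ler_expR.
have Xx : 0 <= X - x by rewrite subr_ge0.
rewrite mulNr subr_ge0 (le_trans (ler_norm _))// normrM ler_wpM2l// ger0_norm//.
by rewrite gerBl.
Qed.

(** By the functional equation the quotient is r (r + 1) ... (r + N - 1), and r >= 1. This makes the
    remainder of the expansion comparable to a term of an exponential series. *)
Lemma Gamma_ge_fact r N : 1 <= r -> N`!%:R * Gamma r <= Gamma (r + N%:R) :> R.
Proof.
move=> r1; have r0 : 0 < r by exact: lt_le_trans r1.
elim: N => [|N IH]; first by rewrite fact0 mul1r addr0.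
have rN0 : 0 < r + N%:R by rewrite ltr_pwDl.
have H : N.+1%:R <= r + N%:R by rewrite -natr1 [leRHS]addrC lerD2l.
have E : Gamma (r + N.+1%:R) = (r + N%:R) * Gamma (r + N%:R).
  by have := GammaD1 rN0; rewrite -addrA natr1.
have N0 := mulr_ge0 (ler0n R N`!) (ltW (Gamma_gt0 r0)).
by rewrite E factS natrM -mulrA; exact: ler_pM.
Qed.

Lemma conv_int_cst1E q X : 0 < q -> 0 <= X ->
  conv_int lam q (cst 1) X =
  expR (- lam * X) * (X `^ q * mittag_leffler 1 (q + 1) (lam * X)).
Proof.
move=> q0; rewrite le_eqVlt => /predU1P[<-|X0].
  by rewrite conv_int_le0// powR0 ?gt_eqF// mul0r mulr0.
rewrite mulrA.
have D0 : expR (- lam * X) * X `^ q != 0 by rewrite gt_eqF// mulr_gt0 ?expR_gt0 ?powR_gt0.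
set D := expR _ * _ in D0 *.
have G0 : 0 < Gamma (q + 1) by rewrite Gamma_gt0// addr_gt0.
(* The factors free of N in the bound for the remainder; what is left is (|lam| X)^N / N!, which
   tends to 0. *)
pose C := expR (`|lam| * X) * D / Gamma (q + 1).
have rem0 : lam ^+ N * conv_int lam (q + N%:R) (cst 1) X @[N --> \oo] --> (0 : R).
  apply/norm_cvg0P.
  have expC : C * exp_coeff (`|lam| * X) N @[N --> \oo] --> (0 : R).
    by rewrite -(mulr0 C); apply: cvgMr; exact: cvg_exp_coeff.
  apply: (squeeze_cvgr _ (@cvg_cst _ _ _ _ _) expC); apply: nearW => N.
  have qN0 : 0 < q + N%:R by rewrite ltr_pwDl.
  rewrite normr_ge0/= normrM normrX.
  rewrite (le_trans (ler_wpM2l _ (conv_int_cst1_le qN0 X0))) ?exprn_ge0//.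
  rewrite /ker /tker X0 addrK powRD ?(gt_eqF X0) ?implybT// powR_mulrn ?(ltW X0)//.
  have GN : (Gamma (q + N%:R + 1))^-1 <= (N`!%:R * Gamma (q + 1))^-1.
    have q11 : 1 <= q + 1 by rewrite lerDr ltW.
    have := Gamma_ge_fact N q11; rewrite addrAC.
    have := Gamma_gt0 (addr_gt0 qN0 ltr01); have Nf : 0 < N`!%:R :> R by rewrite ltr0n fact_gt0.
    move: (Gamma (q + N%:R + 1)) (Gamma (q + 1)) G0 => g1 g2 g20 g10 g12.
    by rewrite lef_pV2 ?posrE// mulr_gt0.
  rewrite /C /D exp_coeffE.
  move: (Gamma (q + N%:R + 1))^-1 (Gamma (q + 1)) GN G0 => g1 g2 GN g20.
  have -> : expR (`|lam| * X) * (expR (- lam * X) * X `^ q) / g2 * (N`!%:R^-1 * (`|lam| * X) ^+ N) =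
      (`|lam| ^+ N * (expR (`|lam| * X) * (X `^ q * X ^+ N * expR (- lam * X)))) * (N`!%:R * g2)^-1.
    by rewrite exprMn invfM; move: (N`!%:R^-1) => ?; ring.
  have -> : `|lam| ^+ N * (expR (`|lam| * X) * (X `^ q * X ^+ N * expR (- lam * X) * g1)) =
      (`|lam| ^+ N * (expR (`|lam| * X) * (X `^ q * X ^+ N * expR (- lam * X)))) * g1 by ring.
  by rewrite ler_wpM2l// !mulr_ge0 ?exprn_ge0 ?expR_ge0 ?powR_ge0 ?(ltW X0).
have cvgS : series (fun j => (lam * X) ^+ j / Gamma (1 * j%:R + (q + 1))) N @[N --> \oo] -->
    D^-1 * conv_int lam q (cst 1) X.
  rewrite (_ : (fun N => _) = (fun N => D^-1 * (conv_int lam q (cst 1) X - lam ^+ N * conv_int lam (q + N%:R) (cst 1) X))).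
    apply: cvgMr; rewrite -[X in _ --> X]subr0; apply: cvgB; [exact: cvg_cst|exact: rem0].
  apply/funext => N; rewrite (conv_int_cst1_partial N q0 X0) addrK.
  by rewrite -/D mulrA mulVf// mul1r.
by rewrite /mittag_leffler (cvg_lim _ cvgS)// mulrA divff// mul1r.
Qed.

End MittagLefflerExpansion.

(** * The function Psi *)

Section Clamp.
Context {R : realType}.
Implicit Types (a c x : R).

(** Precomposition with it turns a function continuous on [a, c] into one continuous on the whole
    line, with the same values on [a, c]. *)
Definition clamp a c x := Num.max a (Num.min x c).

Lemma clamp_id a c x : a <= x <= c -> clamp a c x = x.
Proof. by move=> /andP[ax xc]; rewrite /clamp min_l// max_r. Qed.

Lemma clamp_itv a c x : a <= c -> a <= clamp a c x <= c.
Proof. by move=> ac; rewrite /clamp le_max lexx/= ge_max ac ge_min lexx orbT. Qed.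

Lemma continuous_clamp a c : continuous (clamp a c).
Proof.
move=> x; apply: (@continuous_max _ _ (cst a) (fun x => Num.min x c)); first exact: cvg_cst.
by apply: (@continuous_min _ _ id (cst c)); [exact: cvg_id|exact: cvg_cst].
Qed.

Lemma continuous_comp_clamp a c (f : R -> R) : a <= c ->
  {within `[a, c], continuous f} -> continuous (f \o clamp a c).
Proof.
move=> ac /subspace_continuousP cf x.
have xac : [set` `[a, c]] (clamp a c x) by rewrite /= in_itv/=; exact: clamp_itv.
move=> A /(cf _ xac) H.
have {}H : nbhs x (fun y => [set` `[a, c]] (clamp a c y) -> A (f (clamp a c y))).
  exact: (@continuous_clamp a c x _ H).
change (nbhs x (fun y => A (f (clamp a c y)))).
by apply: filterS H => y; apply; rewrite /= in_itv/=; exact: clamp_itv.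
Qed.

End Clamp.

(** * Strict monotonicity and inversion of Psi *)

Section PsiCalculus.
Context {R : realType}.
Notation mu := (@lebesgue_measure R).
Variables (b : R) (Psi : R -> R).
Hypotheses (b_gt0 : 0 < b) (Psi_smooth : smooth_on b Psi).
Hypothesis Psi_mono : {in `[0, b] &, {homo Psi : x y / x <= y}}.
Hypothesis dPsi_gt0 : {ae mu, forall t, 0 <= t <= b -> 0 < wderive b Psi t}.
Implicit Types (s t : R) (y g : R -> R).

Local Notation p := (wderive b Psi).

Lemma Psi_wquot t : 0 <= t <= b -> wquot b Psi t --> p t.
Proof. by move=> tb; exact: (wderivable_cvg (@Psi_smooth 0%N t tb)). Qed.

Lemma Psi_continuous : {within `[0, b], continuous Psi}.
Proof. by apply: wderivable_continuous => t tb; exact: (@Psi_smooth 0%N t tb). Qed.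

Lemma dPsi_continuous : {within `[0, b], continuous p}.
Proof. by apply: wderivable_continuous => t tb; exact: (@Psi_smooth 1%N t tb). Qed.

Lemma dPsi_ge0 t : 0 <= t <= b -> 0 <= p t.
Proof.
move=> tb; have pF := within_itv_dnbhs_proper b_gt0 tb.
apply: limr_ge; first exact: (@Psi_smooth 0%N t tb).
have sb : \forall s \near within `[0, b] t^', s \in `[0, b] by exact: withinT.
apply: filterS sb => s sb; have tb' : t \in `[0, b] by rewrite in_itv.
have [st|ts] := leP s t.
  by rewrite -mulrNN -invrN !opprB divr_ge0 ?subr_ge0// Psi_mono.
by rewrite divr_ge0 ?subr_ge0 ?(ltW ts)// Psi_mono// ltW.
Qed.

(** An interval of positive length is not contained in a null set. *)
Lemma dPsi_gt0_dense u v : 0 <= u -> u < v -> v <= b -> exists2 s, u < s < v & 0 < p s.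
Proof.
move=> u0 uv vb; apply: contrapT => H; have [N [mN N0 NP]] := dPsi_gt0.
have : (mu `]u, v[ <= mu N)%E.
  apply: (@le_measure _ _ _ mu); [by apply/mem_set; exact: measurable_itv|exact/mem_set|].
  move=> s /=; rewrite in_itv/= => /andP[us sv]; apply: NP => /= Hs.
  apply: H; exists s; first by rewrite us.
  by apply: Hs; rewrite (le_trans u0 (ltW us)) (le_trans (ltW sv)).
rewrite [X in (_ <= X)%E](_ : _ = 0%E)// lebesgue_measure_itv/= lte_fin uv -EFinB.
by rewrite lee_fin subr_le0 leNgt uv.
Qed.

Lemma wquot_is_derive y t (l : R) : 0 < t < b -> wquot b y t --> l -> is_derive t 1 y l.
Proof.
move=> /andP[t0 tb]; have tb' : 0 <= t <= b by rewrite !ltW.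
move=> /(wquot_cvgP _ _ tb') H.
have : (fun h => h^-1 *: ((y \o shift t) (h *: 1) - y t)) @ 0^' --> l.
  apply/cvgrPdist_le => /= e e0; have [d d0 {}H] := H e e0.
  exists (Num.min d (Num.min t (b - t))) => /=.
    by rewrite !lt_min d0 t0/= subr_gt0.
  move=> h /=; rewrite sub0r normrN !lt_min => /and3P[hd ht hb] h0.
  have := H (h + t); rewrite addrK => /(_ _ hd); rewrite [h%:A]mulr1.
  move: ht hb; rewrite !ltr_norml => /andP[h1 h2] /andP[h3 h4].
  move=> /(_ ltac:(by apply/andP; split; lra)) Hh.
  rewrite -(ler_pM2r (_ : 0 < `|h|)) ?normr_gt0//; apply: le_trans Hh.
  by rewrite -normrM mulrBl /GRing.scale/= mulrAC mulVf// mul1r distrC.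
by move=> yl; split; [apply/cvg_ex; exists l|exact/cvg_lim].
Qed.

Lemma integral_dPsi s : 0 <= s <= b ->
  (\int[mu]_(x in `[0%R, s]) (p x)%:E = (Psi s - Psi 0)%:E)%E.
Proof.
move=> /andP[]; rewrite le_eqVlt => /predU1P[<- _|s0 sb].
  by rewrite set_itv1 integral_set1 subrr.
have sub : `[0, s] `<=` `[0, b] by apply: subset_itvl; rewrite bnd_simp.
have dPsi x : x \in `]0, s[ -> is_derive x 1 Psi (p x).
  rewrite in_itv/= => /andP[x0 xs]; have xb : 0 < x < b by rewrite x0 (lt_le_trans xs).
  by apply: wquot_is_derive => //; apply: Psi_wquot; case/andP: xb => ? ?; rewrite !ltW.
have cPs := continuous_subspaceW sub Psi_continuous.
have /(continuous_within_itvP _ s0)[_ cr cl] := cPs.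
rewrite (@continuous_FTC2 _ p Psi 0 s s0) ?EFinB//.
- exact: continuous_subspaceW sub dPsi_continuous.
- by split => // x xs; exact: (@ex_derive _ _ _ _ _ _ _ (dPsi x xs)).
- by move=> x xs; rewrite derive1E (@derive_val _ _ _ _ _ _ _ (dPsi x xs)).
Qed.

(** If Psi u = Psi v, monotonicity makes Psi constant on [u, v], so its derivative is 0 there; but
    [dPsi_gt0_dense] gives a point in between where it is positive. *)
Lemma Psi_lt u v : 0 <= u -> u < v -> v <= b -> Psi u < Psi v.
Proof.
move=> u0 uv vb.
have ub : u \in `[0, b] by rewrite in_itv/= u0 (le_trans (ltW uv)).
have vb' : v \in `[0, b] by rewrite in_itv/= vb (le_trans u0 (ltW uv)).
rewrite lt_neqAle Psi_mono ?(ltW uv)// andbT; apply/eqP => Puv.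
have Pc x : u <= x <= v -> Psi x = Psi u.
  move=> /andP[ux xv]; have xb : x \in `[0, b] by rewrite in_itv/= (le_trans u0)// (le_trans xv).
  by apply/eqP; rewrite eq_le {1}Puv !Psi_mono.
have [s /andP[us sv] ps] := dPsi_gt0_dense u0 uv vb.
have sb : 0 <= s <= b by rewrite (le_trans u0 (ltW us)) (le_trans (ltW sv)).
have := (wquot_cvgP _ _ sb).1 (Psi_wquot sb) (p s / 2) (divr_gt0 ps (ltr0Sn R 1)).
move=> [d d0 H].
pose h := Num.min (d / 2) (v - s).
have h0 : 0 < h by rewrite lt_min divr_gt0//= subr_gt0.
have hd : h <= d / 2 by rewrite ge_min lexx.
have hv : h <= v - s by rewrite ge_min lexx orbT.
have := H (s + h); rewrite addrAC subrr add0r gtr0_norm// !Pc; last 2 first.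
- by rewrite !ltW.
- by apply/andP; split; lra.
move=> /(_ ltac:(by apply/andP; split; lra) ltac:(lra)).
rewrite subrr sub0r normrN gtr0_norm ?mulr_gt0// ler_pM2r//; lra.
Qed.

Definition Psi_inv (u : R) : R := xget 0 [set s | 0 <= s <= b /\ Psi s = u].

Lemma PsiK s : 0 <= s <= b -> Psi_inv (Psi s) = s.
Proof.
move=> sb; rewrite /Psi_inv; case: xgetP => [s' _ [s'b Pss']|/(_ s)]; last by case.
case/andP: sb => s0 sb; case/andP: s'b => s'0 s'b.
case: (ltgtP s' s) => // ss'.
  by have := Psi_lt s'0 ss' sb; rewrite Pss' ltxx.
by have := Psi_lt s0 ss' s'b; rewrite Pss' ltxx.
Qed.

(** The inverse of a continuous injection of a compact interval is continuous, also at the images of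
    critical points, so every continuous y is a continuous function of Psi - Psi 0. The clamps
    extend the inverse and y to the whole line. *)
Lemma Psi_lift y : {within `[0, b], continuous y} ->
  exists2 Y : R -> R, continuous Y & forall s, 0 <= s <= b -> y s = Y (Psi s - Psi 0).
Proof.
move=> cy.
have Pb : Psi 0 <= Psi b by rewrite ltW// Psi_lt.
have cinv : {within `[Psi 0, Psi b], continuous Psi_inv}.
  apply: segment_can_le_continuous (ltW b_gt0) Psi_continuous _ => s.
  by rewrite in_itv/=; exact: PsiK.
have cg := continuous_comp_clamp Pb cinv.
have cy' := continuous_comp_clamp (ltW b_gt0) cy.
exists (fun u => (y \o clamp 0 b) ((Psi_inv \o clamp (Psi 0) (Psi b)) (u + Psi 0))).
  move=> u; apply: continuous_cvg; first exact: cy'.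
  apply: continuous_cvg; first exact: cg.
  by apply: cvgD; [exact: cvg_id|exact: cvg_cst].
move=> s sb /=; case/andP: (sb) => s0 sb'.
have Psb : Psi 0 <= Psi s <= Psi b.
  by rewrite !Psi_mono// in_itv/= ?lexx ?(ltW b_gt0)// s0 sb'.
by rewrite subrK (clamp_id Psb) PsiK// clamp_id.
Qed.

End PsiCalculus.

(** * Tempered integrals *)

Section TemperedIntegral.
Context {R : realType}.
Notation mu := (@lebesgue_measure R).
Variables (b : R) (Psi : R -> R).
Hypotheses (b_gt0 : 0 < b) (Psi_smooth : smooth_on b Psi).
Hypothesis Psi_mono : {in `[0, b] &, {homo Psi : x y / x <= y}}.
Hypothesis dPsi_gt0 : {ae mu, forall t, 0 <= t <= b -> 0 < wderive b Psi t}.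
Variable lam : R.
Implicit Types (s t beta a c : R) (y g : R -> R).

Local Notation p := (wderive b Psi).

Lemma integral_subst_Psi (k : R -> R) t : 0 <= t <= b -> measurable_fun setT k ->
  (\int[mu]_(s in `[0%R, t]) (p s * k (Psi t - Psi s))%R%:E =
   \int[mu]_(x in `[0%R, (Psi t - Psi 0)%R]) (k x)%:E)%E.
Proof.
move=> tb mk; case/andP: (tb) => t0 tb'.
pose P := Psi \o clamp 0 b; pose pc := p \o clamp 0 b.
have cP : continuous P := continuous_comp_clamp (ltW b_gt0) (Psi_continuous Psi_smooth).
have cp : continuous pc := continuous_comp_clamp (ltW b_gt0) (dPsi_continuous Psi_smooth).
have PE s : 0 <= s <= t -> P s = Psi s.
  by move=> /andP[s0 st]; rewrite /P/= clamp_id// s0 (le_trans st).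
have pcE s : 0 <= s <= t -> pc s = p s.
  by move=> /andP[s0 st]; rewrite /pc/= clamp_id// s0 (le_trans st).
have pc0 s : 0 <= pc s.
  by apply: dPsi_ge0 => //; apply: clamp_itv; exact: ltW.
have Pm x z : 0 <= x -> x < z -> z <= t -> P x < P z.
  move=> x0 xz zt; rewrite !PE ?x0 ?zt ?(le_trans x0 (ltW xz)) ?(le_trans (ltW xz))//.
  by apply: (Psi_lt Psi_smooth Psi_mono dPsi_gt0) => //; exact: le_trans tb'.
have FTC s : 0 <= s <= t -> (\int[mu]_(x in `[0%R, s]) (pc x)%:E = (P s - P 0)%:E)%E.
  move=> /andP[s0 st]; rewrite !PE ?s0 ?lexx//.
  rewrite -(integral_dPsi Psi_smooth); last by rewrite s0 (le_trans st).
  apply: eq_integral => x; rewrite inE/= in_itv/= => /andP[x0 xs].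
  by rewrite pcE// x0 (le_trans xs).
have := integral_subst_increasing t0 cP cp pc0 Pm FTC mk.
rewrite !PE ?t0 ?lexx// => <-; apply: eq_integral => s.
by rewrite inE/= in_itv/= => st; rewrite pcE// PE.
Qed.

Lemma tempered_integral_conv beta y (Y : R -> R) t :
  0 < beta -> continuous Y -> (forall s, 0 <= s <= b -> y s = Y (Psi s - Psi 0)) ->
  0 <= t <= b ->
  mu.-integrable `[0, t] (EFin \o tempered_integrand b Psi beta lam y t) /\
  tempered_integral b Psi beta lam y t = conv_int lam beta Y (Psi t - Psi 0).
Proof.
move=> beta0 cY yY tb; case/andP: (tb) => t0 tb'; set X := Psi t - Psi 0.
pose k x := x `^ (beta - 1) * expR (- lam * x) * Y (X - x).
have mY : measurable_fun [set: R] (fun x => Y (X - x)).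
  by apply: continuous_measurable_fun; exact: continuous_reflect.
have mk : measurable_fun [set: R] k.
  apply: measurable_funM => //; apply: measurable_funM; first exact: measurable_powR.
  by apply: continuous_measurable_fun; exact: continuous_expRM.
pose h x := Gamma beta * (ker lam beta x * Y (X - x)).
have mh : measurable_fun [set: R] h.
  by apply: measurable_funM; [exact: measurable_cst|apply: measurable_funM => //; exact: measurable_ker].
have G0 := Gamma_gt0 beta0.
(* At x <= 0 the kernel is cut off but k is not, so all comparisons of the two integrals are made on
   intervals open at 0. *)
have kh x : 0 < x -> k x = h x.
  move=> x0; rewrite /k /h /ker /tker x0; move: (Gamma beta) G0 => G G0.
  by rewrite mulrA [G * _]mulrC divfK ?gt_eqF.
have tE s : 0 <= s <= t -> tempered_integrand b Psi beta lam y t s = p s * k (Psi t - Psi s).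
  move=> /andP[s0 st]; rewrite /tempered_integrand yY ?s0 ?(le_trans st)// /k /X.
  rewrite -!mulrA; congr (_ * (_ * (_ * Y _))); ring.
have mT : measurable_fun `[0, t] (EFin \o tempered_integrand b Psi beta lam y t).
  apply: (@eq_measurable_fun _ _ _ _ `[0, t]
    (EFin \o (fun s => (p \o clamp 0 b) s * k ((Psi \o clamp 0 b) t - (Psi \o clamp 0 b) s)))).
    move=> s; rewrite inE/= in_itv/= => /andP[s0 st].
    by rewrite tE ?s0// !clamp_id// s0 (le_trans st).
  apply: measurable_funTS; apply/measurable_EFinP; apply: measurable_funM.
    apply: continuous_measurable_fun; apply: continuous_comp_clamp; first exact: ltW.
    exact: (dPsi_continuous Psi_smooth).
  apply: (measurableT_comp mk); apply: measurable_funB; first exact: measurable_cst.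
  apply: continuous_measurable_fun; apply: continuous_comp_clamp; first exact: ltW.
  exact: (Psi_continuous Psi_smooth).
have ih : mu.-integrable `[0, X] (EFin \o h).
  rewrite (_ : EFin \o h = fun x => ((Gamma beta)%:E * (EFin \o (fun x => ker lam beta x * Y (X - x)%R)%R) x)%E); last first.
    by apply/funext => x; rewrite /= EFinM.
  by apply: integrableZl => //; exact: integrable_conv_int.
split.
  (* Since Psi' >= 0, the absolute value of the integrand has the same form with |k| for k, and the
     substitution turns its integral into one known to be finite. *)
  apply/integrableP; split => //.
  rewrite (_ : (\int[mu]_(x in _) _)%E = (\int[mu]_(s in `[0%R, t]) (p s * (Num.norm \o k) (Psi t - Psi s))%R%:E)%E); last first.
    apply: eq_integral => s; rewrite inE/= in_itv/= => /andP[s0 st].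
    rewrite tE ?s0// normrM ger0_norm//; apply: dPsi_ge0 => //.
    by rewrite s0 (le_trans st).
  have mnk : measurable_fun [set: R] (Num.norm \o k) by exact: measurableT_comp.
  rewrite integral_subst_Psi//.
  rewrite -integral_itv_obnd_cbnd; last by apply: measurable_funTS; exact/measurable_EFinP.
  have /integrableP[_] := ih; apply: le_lt_trans.
  rewrite (_ : (\int[mu]_(x in _) _)%E = (\int[mu]_(x in `]0%R, X]) `|(EFin \o h) x|)%E); last first.
    by apply: eq_integral => x; rewrite inE/= in_itv/= => /andP[x0 _]; rewrite /= kh.
  apply: ge0_subset_integral => //=.
    by apply: measurable_funTS; apply/measurable_EFinP; exact: measurableT_comp.
  by apply: subset_itvr; rewrite bnd_simp.
rewrite /tempered_integral /conv_int.
have -> : \int[mu]_(s in `[0, t]) tempered_integrand b Psi beta lam y t s =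
    \int[mu]_(x in `[0, X]) h x.
  rewrite /Rintegral; congr fine.
  rewrite (_ : (\int[mu]_(x in `[0%R, t]) _)%E = (\int[mu]_(s in `[0%R, t]) (p s * k (Psi t - Psi s))%R%:E)%E); last first.
    by apply: eq_integral => s; rewrite inE/= in_itv/= => st; rewrite tE.
  rewrite integral_subst_Psi//.
  rewrite -integral_itv_obnd_cbnd; last by apply: measurable_funTS; exact/measurable_EFinP.
  rewrite -[RHS]integral_itv_obnd_cbnd; last by apply: measurable_funTS; exact/measurable_EFinP.
  by apply: eq_integral => x; rewrite inE/= in_itv/= => /andP[x0 _]; rewrite kh.
rewrite /h RintegralZl//; last exact: integrable_conv_int.
by rewrite mulrA mulVf ?mul1r// gt_eqF.
Qed.

Lemma tempered_integral_exists_continuous beta y : 0 < beta ->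
  {within `[0, b], continuous y} -> tempered_integral_exists b Psi beta lam y.
Proof.
move=> beta0 cy t tb.
have [Y cY yY] := Psi_lift b_gt0 Psi_smooth Psi_mono dPsi_gt0 cy.
by have [] := tempered_integral_conv beta0 cY yY tb.
Qed.

Lemma tempered_integral_continuous beta y : 0 < beta ->
  {within `[0, b], continuous y} ->
  {within `[0, b], continuous (tempered_integral b Psi beta lam y)}.
Proof.
move=> beta0 cy; have [Y cY yY] := Psi_lift b_gt0 Psi_smooth Psi_mono dPsi_gt0 cy.
apply: (@subspace_eq_continuous _ _ _ (fun t => conv_int lam beta Y (Psi t - Psi 0))).
  move=> t; rewrite inE/= in_itv/= => tb.
  have [_ E] := tempered_integral_conv beta0 cY yY tb; exact: esym E.
have cJ := @continuous_conv_int R lam beta Y beta0 cY.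
move=> t; apply: continuous_cvg; first exact: cJ.
by apply: cvgB; [exact: (Psi_continuous Psi_smooth)|exact: cvg_cst].
Qed.

Lemma tempered_integralA a c y t : 0 < a -> 0 < c -> {within `[0, b], continuous y} ->
  0 <= t <= b ->
  tempered_integral b Psi a lam (tempered_integral b Psi c lam y) t =
  tempered_integral b Psi (a + c) lam y t.
Proof.
move=> a0 c0 cy tb.
have [Y cY yY] := Psi_lift b_gt0 Psi_smooth Psi_mono dPsi_gt0 cy.
have [_ ->] := tempered_integral_conv (addr_gt0 a0 c0) cY yY tb.
have [_ ->] := tempered_integral_conv a0 (@continuous_conv_int R lam c Y c0 cY)
  (fun s sb => (tempered_integral_conv c0 cY yY sb).2) tb.
exact: conv_intA.
Qed.

Lemma eq_tempered_integral beta y g t : 0 <= t <= b ->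
  (forall s, 0 <= s <= b -> y s = g s) ->
  tempered_integral b Psi beta lam y t = tempered_integral b Psi beta lam g t.
Proof.
move=> /andP[t0 tb] yg; congr (_ * _); apply: eq_Rintegral => s.
rewrite inE/= in_itv/= => /andP[s0 st]; rewrite /tempered_integrand yg//.
by rewrite s0 (le_trans st).
Qed.

Lemma tempered_integral0 beta y : tempered_integral b Psi beta lam y 0 = 0.
Proof. by rewrite /tempered_integral set_itv1 Rintegral_set1 mulr0. Qed.

End TemperedIntegral.

(** * The tempered differential operator *)

Section TemperedOperator.
Context {R : realType}.
Notation mu := (@lebesgue_measure R).
Variables (b : R) (Psi : R -> R).
Hypotheses (b_gt0 : 0 < b) (Psi_smooth : smooth_on b Psi).
Hypothesis Psi_mono : {in `[0, b] &, {homo Psi : x y / x <= y}}.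
Hypothesis dPsi_gt0 : {ae mu, forall t, 0 <= t <= b -> 0 < wderive b Psi t}.
Variable lam : R.
Implicit Types (s t c : R) (y z g h : R -> R).

Local Notation p := (wderive b Psi).
Local Notation I := (tempered_integral b Psi).
Local Notation op := (tempered_op b Psi lam).

(** Noncritical points are dense, so the limit that defines [psi_derive] at a critical point is
    unique. *)
Lemma noncritical_filter t : 0 <= t <= b ->
  ProperFilter (within (noncritical b Psi) (nbhs t)).
Proof.
move=> /andP[t0 tb]; apply: Build_ProperFilter_ex => A.
rewrite /within/= => /nbhs_ballP[e /= e0 H].
pose u := Num.max 0 (t - e); pose v := Num.min b (t + e).
have uv : u < v.
  by rewrite gt_max !lt_min b_gt0/=; apply/andP; split; [|apply/andP; split]; lra.
have [||s /andP[us sv] ps] := dPsi_gt0_dense dPsi_gt0 (u := u) (v := v) _ uv _.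
- by rewrite le_max lexx.
- by rewrite ge_min lexx.
move: us sv; rewrite gt_max lt_min => /andP[s0 se] /andP[sb se'].
exists s; apply: H.
  by rewrite /ball/= ltr_distl; apply/andP; split; lra.
by split; [rewrite !ltW|rewrite gt_eqF].
Qed.

(** The quotient y' / Psi' equals h at noncritical points, and continuity of h carries this value
    over to the critical ones. *)
Lemma psi_derive_continuous y h : {within `[0, b], continuous h} ->
  (forall t, 0 <= t <= b -> wquot b y t --> p t * h t) ->
  psi_derivable b Psi y /\ forall t, 0 <= t <= b -> psi_derive b Psi y t = h t.
Proof.
move=> ch yh.
have dy t : 0 <= t <= b -> wderive b y t = p t * h t.
  by move=> tb; have [_ ->] := wquot_lim b_gt0 tb (yh t tb).
have qh t : noncritical b Psi t -> psi_quot b Psi y t = h t.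
  by move=> [tb pt]; rewrite /psi_quot dy// mulrA mulVf ?mul1r.
have lim_q t : 0 <= t <= b ->
    psi_quot b Psi y s @[s --> within (noncritical b Psi) (nbhs t)] --> h t.
  move=> tb; apply: (@cvg_trans _ (h s @[s --> within (noncritical b Psi) (nbhs t)])).
    have D : \forall s \near within (noncritical b Psi) (nbhs t), noncritical b Psi s.
      exact: withinT.
    by apply: near_eq_cvg; apply: filterS D => s Ds; rewrite qh.
  move/subspace_continuousP : ch => /(_ t) cht.
  have tb' : [set` `[0, b]] t by rewrite /= in_itv.
  move=> A /(cht tb') HA.
  have {}HA : nbhs t (fun s => [set` `[0, b]] s -> A (h s)) by exact: HA.
  change (nbhs t (fun s => noncritical b Psi s -> A (h s))).
  by apply: filterS HA => s Hs [sb _]; apply: Hs; rewrite /= in_itv.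
split => t tb.
  split; first by have [] := wquot_lim b_gt0 tb (yh t tb).
  by move=> _; apply/cvg_ex; exists (h t); exact: lim_q.
rewrite /psi_derive; case: ifPn => [pt|_]; first by rewrite qh.
have pF := noncritical_filter tb.
by apply/cvg_lim => //; exact: lim_q.
Qed.

(** Identities between functions are known on [0, b] only; this and the following congruences carry
    them through the operators. *)
Lemma eq_psi_quot y z t : 0 <= t <= b -> (forall s, 0 <= s <= b -> y s = z s) ->
  psi_quot b Psi y t = psi_quot b Psi z t.
Proof. by move=> tb yz; rewrite /psi_quot (eq_wderive tb yz). Qed.

Lemma eq_psi_quot_filter y z t : (forall s, 0 <= s <= b -> y s = z s) ->
  psi_quot b Psi y s @[s --> within (noncritical b Psi) (nbhs t)] =
  psi_quot b Psi z s @[s --> within (noncritical b Psi) (nbhs t)].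
Proof.
move=> yz; have D : \forall s \near within (noncritical b Psi) (nbhs t), noncritical b Psi s.
  exact: withinT.
by apply/seteqP; split => A /= H; apply: filterS2 D H => s [sb _] /=; rewrite (eq_psi_quot sb yz).
Qed.

Lemma eq_psi_derivable y z : (forall s, 0 <= s <= b -> y s = z s) ->
  psi_derivable b Psi y -> psi_derivable b Psi z.
Proof.
move=> yz dy t tb; have [dyt cy] := dy t tb; split; first exact: eq_wderivable yz dyt.
by rewrite -(eq_psi_quot_filter _ yz).
Qed.

Lemma eq_tempered_op y z : (forall s, 0 <= s <= b -> y s = z s) ->
  forall t, 0 <= t <= b -> op y t = op z t.
Proof.
move=> yz t tb; rewrite /tempered_op /psi_derive (eq_psi_quot tb yz) (yz t tb).
by rewrite (eq_psi_quot_filter _ yz).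
Qed.

Lemma eq_iter_tempered_op y z j : (forall s, 0 <= s <= b -> y s = z s) ->
  forall t, 0 <= t <= b -> iter j op y t = iter j op z t.
Proof. by move=> yz; elim: j => //= j IH; exact: eq_tempered_op. Qed.

Lemma wquot_tempered_integral1 g t : {within `[0, b], continuous g} -> 0 <= t <= b ->
  wquot b (I 1 lam g) t --> p t * (g t - lam * I 1 lam g t).
Proof.
move=> cg tb; have [Y cY gY] := Psi_lift b_gt0 Psi_smooth Psi_mono dPsi_gt0 cg.
have [H [HE dH]] := conv_int1_primitive lam cY.
have Pt0 s : 0 <= s <= b -> 0 <= Psi s - Psi 0.
  move=> sb; rewrite subr_ge0 Psi_mono ?in_itv//=; first by rewrite lexx ltW.
  by case/andP: sb.
have IE s : 0 <= s <= b -> I 1 lam g s = H (Psi s - Psi 0).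
  move=> sb; rewrite HE ?Pt0//.
  by have [_] := tempered_integral_conv b_gt0 Psi_smooth Psi_mono dPsi_gt0 lam ltr01 cY gY sb.
rewrite (eq_wquot tb IE) IE// gY// mulrC.
apply: (@wquot_comp _ b (fun s => Psi s - Psi 0) H) => //; last exact/dH/Pt0.
apply/(wquot_cvgP _ _ tb) => e e0; have [d d0 Hd] := (wquot_cvgP _ _ tb).1 (Psi_wquot Psi_smooth tb) e e0.
by exists d => // s sb sd; have := Hd s sb sd; rewrite opprB addrA subrK.
Qed.

Lemma tempered_op_integral1 g : {within `[0, b], continuous g} ->
  psi_derivable b Psi (I 1 lam g) /\ forall t, 0 <= t <= b -> op (I 1 lam g) t = g t.
Proof.
move=> cg; have cI := tempered_integral_continuous b_gt0 Psi_smooth Psi_mono dPsi_gt0 (lam := lam) ltr01 cg.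
have ch : {within `[0, b], continuous (fun t => g t - lam * I 1 lam g t)}.
  move=> t; apply: cvgB; first exact: cg.
  by apply: cvgM; [exact: cvg_cst|exact: cI].
have [d dE] := psi_derive_continuous ch (fun t tb => wquot_tempered_integral1 cg tb).
by split => // t tb; rewrite /tempered_op dE// subrK.
Qed.

(** By the semigroup property each unit of order splits off as an outer integral of order 1, which
    one application of the operator cancels. *)
Lemma iter_tempered_op_integral c j g : 0 < c -> {within `[0, b], continuous g} ->
  forall t, 0 <= t <= b -> iter j op (I (c + j%:R) lam g) t = I c lam g t.
Proof.
move=> c0 cg; elim: j => [|j IH] t tb; first by rewrite addr0.
have cj0 : 0 < c + j%:R by rewrite ltr_pwDl.
have E : 1 + (c + j%:R) = c + j.+1%:R by rewrite -natr1; ring.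
rewrite iterSr -(IH t tb); apply: eq_iter_tempered_op tb => s sb.
have cI := tempered_integral_continuous b_gt0 Psi_smooth Psi_mono dPsi_gt0 (lam := lam) cj0 cg.
rewrite -((tempered_op_integral1 cI).2 s sb); apply: eq_tempered_op => // u ub.
by rewrite (tempered_integralA b_gt0 Psi_smooth Psi_mono dPsi_gt0 lam ltr01 cj0 cg ub) E.
Qed.

(* The difference w of two solutions satisfies (exp(lam Psi) w)' = 0 almost
   everywhere, namely where Psi' does not vanish. *)
Lemma tempered_op_unique y g : psi_derivable b Psi y -> y 0 = 0 ->
  {within `[0, b], continuous g} -> (forall t, 0 <= t <= b -> op y t = g t) ->
  forall t, 0 <= t <= b -> y t = I 1 lam g t.
Proof.
move=> dy y0 cg yg; set w := I 1 lam g.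
have [dw wg] := tempered_op_integral1 cg.
pose E s := expR (lam * Psi s); pose z s := E s * (y s - w s).
have yE t : 0 <= t <= b -> wquot b y t --> wderive b y t.
  by move=> tb; have [/wderivable_cvg] := dy t tb.
have wE t : 0 <= t <= b -> wquot b w t --> wderive b w t.
  by move=> tb; have [/wderivable_cvg] := dw t tb.
have zE t : 0 <= t <= b ->
    wquot b z t --> (lam * E t * p t) * (y t - w t) + E t * (wderive b y t - wderive b w t).
  move=> tb; apply: wquotM => //.
    exact: (wquot_comp tb (Psi_wquot Psi_smooth tb) (is_derive_expRM lam (Psi t))).
  have wN : wquot b (fun s => - w s) t --> - wderive b w t.
    apply/(wquot_cvgP _ _ tb) => e e0; have [d d0 Hd] := (wquot_cvgP _ _ tb).1 (wE t tb) e e0.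
    exists d => // s sb sd; have := Hd s sb sd.
    move: (wderive b w t) (w s) (w t) => l u v; rewrite -normrN.
    by have -> : - (u - v - l * (s - t)) = - u - - v - - l * (s - t) by ring.
  exact: wquotD (yE t tb) wN.
have zlim t tb := wquot_lim b_gt0 tb (zE t tb).
have zcst := @wderive_ae0_cst R b z b_gt0 (fun t tb => (zlim t tb).1).
have z0 t : 0 <= t <= b -> z t = z 0.
  apply: zcst; case: dPsi_gt0 => N [mN N0 NP]; exists N; split => // s /= Hs; apply: NP => /= Hp.
  apply: Hs => sb; have ps := Hp sb; have [_ ->] := zlim s sb.
  (* Where Psi' > 0 the equation reads v' = Psi' (g - lam v); inserted for y and for w, it makes the
     two terms of z' cancel. *)
  have D v : psi_derivable b Psi v -> op v s = g s -> wderive b v s = p s * (g s - lam * v s).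
    move=> _; rewrite /tempered_op /psi_derive gt_eqF//= /psi_quot => <-.
    by rewrite addrK mulrA mulfV ?mul1r// gt_eqF.
  rewrite (D y dy (yg s sb)) (D w dw (wg s sb)); ring.
move=> t tb; have := z0 t tb; rewrite {2}/z y0 /w tempered_integral0 subr0 mulr0.
by move/eqP; rewrite mulf_eq0 expR_eq0/= subr_eq0 => /eqP.
Qed.

End TemperedOperator.

(** * The Taylor formula *)

Section MeanValue.
Context {R : realType}.
Notation mu := (@lebesgue_measure R).
Variable lam : R.
Implicit Types (a X : R) (Y : R -> R).

(** The integrand is positive on ]0, X[; if the integral were 0 it would vanish almost everywhere on
    this interval, which has positive measure. Positivity of Y is asked on the open interval only,
    which is what later puts the mean value point strictly inside. *)
Lemma conv_int_gt0 a Y X : 0 < a -> 0 < X -> continuous Y ->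
  (forall u, 0 < u < X -> 0 < Y u) -> 0 < conv_int lam a Y X.
Proof.
move=> a0 X0 cY Ypos.
pose q x := ker lam a x * Y (X - x).
have iq : mu.-integrable `[0, X] (EFin \o q) by exact: integrable_conv_int.
have mq : measurable_fun [set: R] q.
  apply: measurable_funM; first exact: measurable_ker.
  by apply: continuous_measurable_fun; exact: continuous_reflect.
have mq' : measurable_fun [set: R] (EFin \o q) by exact/measurable_EFinP.
have qpos x : 0 < x < X -> 0 < q x.
  move=> /andP[x0 xX]; rewrite mulr_gt0//; last by apply: Ypos; apply/andP; split; lra.
  by rewrite /ker /tker x0 divr_gt0 ?Gamma_gt0// mulr_gt0 ?powR_gt0 ?expR_gt0.
have intE : (\int[mu]_(x in `[0%R, X]) (q x)%:E = \int[mu]_(x in `]0%R, X[) `|(EFin \o q) x|)%E.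
  rewrite integral_itv_bndoo; last exact: measurable_funTS.
  apply: eq_integral => x; rewrite inE/= in_itv/= => x0X.
  by rewrite gtr0_norm ?qpos.
have cE : (conv_int lam a Y X)%:E = (\int[mu]_(x in `[0%R, X]) (q x)%:E)%E.
  by rewrite /conv_int /Rintegral fineK//; apply: integrable_fin_num.
rewrite -lte_fin cE intE lt_neqAle integral_ge0 ?andbT; last by move=> x _; exact: abse_ge0.
apply/eqP => /esym /(ae_eq_integral_abs mu (measurable_itv _) (measurable_funTS mq')).1.
move=> [N [mN N0 NP]].
have : (mu `]0%R, X[ <= mu N)%E.
  apply: (@le_measure _ _ _ mu); [by apply/mem_set; exact: measurable_itv|exact/mem_set|].
  move=> x /=; rewrite in_itv/= => x0X; apply: NP => /= H.
  have := H _; rewrite in_itv/= => /(_ x0X)[qx0].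
  by have := qpos x x0X; rewrite qx0 ltxx.
rewrite [X in (_ <= X)%E](_ : _ = 0%E)// lebesgue_measure_itv/= lte_fin X0 -EFinB.
by rewrite lee_fin subr0 leNgt X0.
Qed.

(** A is the weighted mean of Y. If Y missed A on ]0, X[, it would stay on one side of A there by
    the intermediate value theorem, and the convolution of Y - A, which is 0, would have a strict
    sign. *)
Lemma conv_int_mean a Y X : 0 < a -> 0 < X -> continuous Y ->
  exists2 u, 0 < u < X & conv_int lam a Y X = conv_int lam a (cst 1) X * Y u.
Proof.
move=> a0 X0 cY.
have cc r : continuous (cst r : R -> R) by move=> ?; exact: cvg_cst.
have W0 : 0 < conv_int lam a (cst 1) X by apply: conv_int_gt0.
set W := conv_int lam a (cst 1) X in W0 *; pose A := conv_int lam a Y X / W.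
have cE r : conv_int lam a (cst r) X = r * W.
  rewrite -conv_intZ//; apply: eq_conv_int => x _.
  by rewrite /= mulr1.
have AE : A * W = conv_int lam a Y X by rewrite divfK// gt_eqF.
suff [u uX Yu] : exists2 u, 0 < u < X & Y u = A by exists u => //; rewrite Yu mulrC.
apply: contrapT => noA.
have nA u : 0 < u < X -> Y u != A by move=> uX; apply/eqP => Yu; apply: noA; exists u.
have side u v : 0 < u < X -> 0 < v < X -> A < Y u -> A < Y v.
  move=> uX vX Au; rewrite ltNge; apply/negP => vA; have mX : 0 < Num.min u v.
    by rewrite lt_min; case/andP: uX => -> _; case/andP: vX => ->.
  have MX : Num.max u v < X by rewrite gt_max; case/andP: uX => _ ->; case/andP: vX.
  have mM : Num.min u v <= Num.max u v by rewrite ge_min !le_max lexx.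
  have cY' : {within `[Num.min u v, Num.max u v], continuous Y} by exact: continuous_subspaceT.
  have [|c] := @IVT R Y _ _ A mM cY'.
    case: (leP u v) => _.
      by rewrite ge_min le_max vA (ltW Au) orbT.
    by rewrite ge_min le_max vA (ltW Au) orbT.
  rewrite in_itv/= => /andP[mc cM] Yc; have := nA c.
  by rewrite Yc eqxx (lt_le_trans mX mc) (le_lt_trans cM MX) => /(_ isT).
(* The midpoint serves to decide on which side of A the function Y lies. *)
have hX : 0 < X / 2 < X by apply/andP; split; lra.
have [Ah|hA] := ltP A (Y (X / 2)).
  have := @conv_int_gt0 a (fun x => Y x - cst A x) X a0 X0.
  rewrite conv_intB// cE AE subrr ltxx => H; suff : false by []; apply: H.
    by move=> x; apply: cvgB; [exact: cY|exact: cvg_cst].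
  by move=> u uX; rewrite subr_gt0; exact: (side _ _ hX uX Ah).
have := @conv_int_gt0 a (fun x => cst A x - Y x) X a0 X0.
rewrite conv_intB// cE AE subrr ltxx => H; suff : false by []; apply: H.
  by move=> x; apply: cvgB; [exact: cvg_cst|exact: cY].
move=> u uX; rewrite subr_gt0 lt_neqAle nA//= leNgt; apply/negP => Au.
by have := side _ _ uX hX Au; rewrite ltNge hA.
Qed.

End MeanValue.

(** * From the single derivatives of order k alpha to the composed ones *)

Section RiemannLiouville.
Context {R : realType}.
Notation mu := (@lebesgue_measure R).
Variables (b : R) (Psi : R -> R).
Hypotheses (b_gt0 : 0 < b) (Psi_smooth : smooth_on b Psi).
Hypothesis Psi_mono : {in `[0, b] &, {homo Psi : x y / x <= y}}.
Hypothesis dPsi_gt0 : {ae mu, forall t, 0 <= t <= b -> 0 < wderive b Psi t}.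
Variables (alpha lam : R).
Hypothesis alpha01 : 0 < alpha < 1.
Implicit Types (s t a : R) (f y g G : R -> R).

Local Notation I := (tempered_integral b Psi).
Local Notation op := (tempered_op b Psi lam).
Local Notation D := (TRD b Psi alpha lam).

Lemma order_lt1 : (alpha \is a Num.nat) = false /\ Num.truncn alpha = 0%N.
Proof.
case/andP: alpha01 => a0 a1; have tr : Num.truncn alpha = 0%N.
  by apply: truncn_def; rewrite (ltW a0).
by split => //; rewrite natrEtruncn tr eq_sym gt_eqF.
Qed.

Lemma TRD_lt1 y : D y = op (I (1 - alpha) lam y).
Proof. by rewrite /TRD; have [-> ->] := order_lt1. Qed.

Lemma TRD_exists_lt1 y : {within `[0, b], continuous y} ->
  psi_derivable b Psi (I (1 - alpha) lam y) -> TRD_exists b Psi alpha lam y.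
Proof.
move=> cy dI; rewrite /TRD_exists; have [-> ->] := order_lt1; split.
  apply: (tempered_integral_exists_continuous b_gt0 Psi_smooth Psi_mono dPsi_gt0) => //.
  by case/andP: alpha01 => _; rewrite subr_gt0.
by move=> j; rewrite ltnS leqn0 => /eqP ->; exact: dI.
Qed.

(** A common shape for integer and non-integer orders, with at least one operator outside, so that
    the last one can be peeled off without a case distinction. *)
Lemma TRD_iter gamma y : 0 < gamma -> exists N F,
  [/\ TRD b Psi gamma lam y = iter N.+1 op F,
      TRD_exists b Psi gamma lam y -> tempered_op_exists b Psi lam N.+1 F &
      (gamma = N.+1%:R /\ F = y) \/
      (0 < N.+1%:R - gamma /\ F = I (N.+1%:R - gamma) lam y)].
Proof.
move=> g0; rewrite /TRD /TRD_exists natrEtruncn; case: eqP => gE.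
  case: (Num.truncn gamma) gE => [gE|N gE]; first by move: g0; rewrite -gE ltxx.
  by exists N, y; split => //; left.
exists (Num.truncn gamma), (I ((Num.truncn gamma).+1%:R - gamma) lam y).
split => //; [by move=> [_ H]; exact: H|right; split => //].
by rewrite subr_gt0 truncnS_gt.
Qed.

(** The inductive step with a = k alpha. Whatever the integer part of a + alpha, all operators but
    the last reduce f to I^(1-alpha) G, so G' is also the derivative of order alpha of G. Order a =
    0 is a separate alternative because there f is G itself and not one of its integrals. *)
Lemma TRD_step f G a : {within `[0, b], continuous G} ->
  (a = 0 /\ forall t, 0 <= t <= b -> f t = G t) \/
  (0 < a /\ forall t, 0 <= t <= b -> f t = I a lam G t) ->
  TRD_exists b Psi (a + alpha) lam f ->
  {within `[0, b], continuous (TRD b Psi (a + alpha) lam f)} ->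
  let G' := TRD b Psi (a + alpha) lam f in
  [/\ psi_derivable b Psi (I (1 - alpha) lam G),
     forall t, 0 <= t <= b -> op (I (1 - alpha) lam G) t = G' t &
     forall t, 0 <= t <= b -> f t = I (a + alpha) lam G' t].
Proof.
move=> cG fG; case/andP: alpha01 => a0 a1.
have na0 : 0 < 1 - alpha by rewrite subr_gt0.
have aa0 : 0 < a + alpha by case: fG => -[]; [move=> ->; rewrite add0r|move=> ? _; exact: addr_gt0].
have [N [F [-> Fex Feq]]] := TRD_iter f aa0.
move=> /Fex {}Fex; set G' := iter N.+1 op F => cG' /=.
have IA := tempered_integralA b_gt0 Psi_smooth Psi_mono dPsi_gt0 lam.
(* When a + alpha is the integer N + 1, F is f itself and a = N + 1 - alpha; this is positive as
   alpha < 1, which rules out a = 0. *)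
have FE t : 0 <= t <= b -> F t = I (1 - alpha + N%:R) lam G t.
  move=> tb; case: Feq => -[gN ->].
    have aE : a = 1 - alpha + N%:R by apply: (addIr alpha); rewrite gN -natr1; ring.
    case: fG => -[a_eq fG]; last by rewrite (fG t tb) -aE.
    have : 0 < a by rewrite aE ltr_wpDr.
    by rewrite a_eq ltxx.
  have E : N.+1%:R - (a + alpha) + a = 1 - alpha + N%:R by rewrite -natr1; ring.
  case: fG => -[a_eq fG].
    rewrite (eq_tempered_integral _ _ _ tb fG) -E a_eq addr0.
    by [].
  by rewrite (eq_tempered_integral _ _ _ tb fG) (IA _ _ _ _ gN a_eq cG tb) E.
have FN t : 0 <= t <= b -> iter N op F t = I (1 - alpha) lam G t.
  move=> tb; rewrite (eq_iter_tempered_op Psi lam N FE tb).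
  exact: (iter_tempered_op_integral b_gt0 Psi_smooth Psi_mono dPsi_gt0).
have dI : psi_derivable b Psi (I (1 - alpha) lam G).
  exact: eq_psi_derivable FN (Fex N (ltnSn N)).
have opI t : 0 <= t <= b -> op (I (1 - alpha) lam G) t = G' t.
  by move=> tb; rewrite /G' iterS; exact: esym (eq_tempered_op Psi lam FN tb).
have IG := tempered_op_unique b_gt0 Psi_smooth Psi_mono dPsi_gt0 dI
  (tempered_integral0 _ _ _ _ _) cG' opI.
have cIG' := tempered_integral_continuous b_gt0 Psi_smooth Psi_mono dPsi_gt0 (lam := lam) a0 cG'.
(* Both sides are recovered by applying the operator to their order-one integrals, which agree: I^1
   I^alpha G' = I^alpha I^1 G' = I^alpha I^(1-alpha) G = I^1 G. *)
have GE t : 0 <= t <= b -> G t = I alpha lam G' t.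
  move=> tb; rewrite -((tempered_op_integral1 b_gt0 Psi_smooth Psi_mono dPsi_gt0 lam cG).2 t tb).
  rewrite -((tempered_op_integral1 b_gt0 Psi_smooth Psi_mono dPsi_gt0 lam cIG').2 t tb).
  apply: (fun H => eq_tempered_op Psi lam H tb) => s sb.
  rewrite (IA _ _ _ _ ltr01 a0 cG' sb) [1 + alpha]addrC -(IA _ _ _ _ a0 ltr01 cG' sb).
  rewrite -(eq_tempered_integral Psi lam alpha sb IG) (IA _ _ _ _ a0 na0 cG sb).
  by rewrite addrCA subrr addr0.
split; [exact: dI|exact: opI|move=> t tb; case: fG => -[a_eq fG]].
  by rewrite a_eq add0r (fG t tb) (GE t tb).
by rewrite (fG t tb) (eq_tempered_integral Psi lam a tb GE) (IA _ _ _ _ a_eq a0 cG' tb).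
Qed.

(** Only single derivatives are assumed to exist; the existence of the composed ones is carried
    along the induction, since knowing their values as limits would say nothing without it. *)
Lemma TRD_iterate f (m : nat) :
  (forall k : nat, (k <= m)%N ->
     TRD_exists b Psi (k%:R * alpha) lam f /\
     {within `[0, b], continuous (TRD b Psi (k%:R * alpha) lam f)}) ->
  forall k, (k <= m)%N ->
  [/\ forall t, 0 <= t <= b -> iter k D f t = TRD b Psi (k%:R * alpha) lam f t,
     (k = 0%N \/ forall t, 0 <= t <= b ->
        f t = I (k%:R * alpha) lam (TRD b Psi (k%:R * alpha) lam f) t) &
     forall j, (j < k)%N -> TRD_exists b Psi alpha lam (iter j D f)].
Proof.
move=> H; case/andP: alpha01 => a0 a1.
have TRD0 : TRD b Psi (0%:R * alpha) lam f = f.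
  by rewrite mul0r /TRD natrEtruncn truncn0 eqxx.
elim=> [_|k IH km]; first by split; [rewrite TRD0|left|].
have [IHk fk exk] := IH (ltnW km); have [_ cG] := H k (ltnW km).
set G := TRD b Psi (k%:R * alpha) lam f in IHk fk cG.
have kE : k.+1%:R * alpha = k%:R * alpha + alpha by rewrite -natr1 mulrDl mul1r.
have [ex' cG'] := H k.+1 km; rewrite kE in ex' cG' *.
have fG : (k%:R * alpha = 0 /\ forall t, 0 <= t <= b -> f t = G t) \/
  (0 < k%:R * alpha /\ forall t, 0 <= t <= b -> f t = I (k%:R * alpha) lam G t).
  case: (posnP k) => [k0|k0].
    by left; rewrite k0 mul0r; split => // t tb; rewrite /G k0 TRD0.
  by case: fk => [k_eq|fk]; [move: k0; rewrite k_eq|right; rewrite mulr_gt0 ?ltr0n].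
have [dI opI fE] := TRD_step cG fG ex' cG'.
have cit : {within `[0, b], continuous (iter k D f)}.
  apply: (@subspace_eq_continuous _ _ _ G); last exact: cG.
  by move=> t; rewrite inE/= in_itv/= => tb; exact: esym (IHk t tb).
split; last 2 first.
- by right.
- move=> j; rewrite ltnS leq_eqVlt => /predU1P[->|]; last exact: exk.
  apply: (TRD_exists_lt1 cit); apply: eq_psi_derivable dI => s sb.
  by apply: (eq_tempered_integral _ _ _ sb) => u ub; rewrite (IHk u ub).
move=> t tb; rewrite iterS TRD_lt1 -(opI t tb); apply: (fun H => eq_tempered_op Psi lam H tb) => s sb.
by apply: (eq_tempered_integral _ _ _ sb) => u ub; rewrite (IHk u ub).
Qed.

(** The intermediate value theorem for Psi pulls the mean value point in the variable u back to c; c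
    is neither 0 nor t because u is neither 0 nor Psi t - Psi 0. *)
Lemma tempered_integral_mean beta g t : 0 < beta -> {within `[0, b], continuous g} ->
  0 < t <= b -> exists2 c, 0 < c < t &
  I beta lam g t = conv_int lam beta (cst 1) (Psi t - Psi 0) * g c.
Proof.
move=> beta0 cg /andP[t0 tb]; have tb' : 0 <= t <= b by rewrite ltW.
have [Y cY gY] := Psi_lift b_gt0 Psi_smooth Psi_mono dPsi_gt0 cg.
have [_ ->] := tempered_integral_conv b_gt0 Psi_smooth Psi_mono dPsi_gt0 lam beta0 cY gY tb'.
have X0 : 0 < Psi t - Psi 0.
  by rewrite subr_gt0 (Psi_lt Psi_smooth Psi_mono dPsi_gt0).
have [u /andP[u0 uX] ->] := conv_int_mean lam beta0 X0 cY.
have sub : `[0, t] `<=` `[0, b] by apply: subset_itvl; rewrite bnd_simp.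
have cPs := continuous_subspaceW sub (Psi_continuous Psi_smooth).
have [|c] := @IVT R Psi 0 t (u + Psi 0) (ltW t0) cPs.
  by rewrite ge_min le_max; apply/andP; split; apply/orP; [left|right]; lra.
rewrite in_itv/= => /andP[c0 ct] Pc; exists c.
  rewrite !lt_neqAle c0 ct !andbT; apply/andP; split; apply/eqP => cE.
    by move: u0; rewrite -[u](addrK (Psi 0)) -Pc -cE subrr ltxx.
  by move: uX; rewrite ltrBrDr -Pc cE ltxx.
by rewrite gY ?c0 ?(le_trans ct)// Pc addrK.
Qed.

End RiemannLiouville.

(** The first conclusion makes the composed derivatives in the formula meaningful. At t = 0 the
    interval (0, t) is empty, so c is asked to lie in [0, t], and strictly inside as soon as 0 <
    t. *)
Theorem theorem4p6 (R : realType) (b : R) (Psi : R -> R)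
    (b_gt0 : 0 < b)
    (Psi_smooth : smooth_on b Psi)
    (Psi_mono : {in `[0, b] &, {homo Psi : x y / x <= y}})
    (dPsi_gt0 : {ae (@lebesgue_measure R),
                  forall t, 0 <= t <= b -> 0 < wderive b Psi t})
    (alpha lam : R) (n : nat) (f : R -> R)
    (alpha01 : 0 < alpha < 1)
    (f_TRD : forall k : nat, (k <= n.+1)%N ->
       TRD_exists b Psi (k%:R * alpha) lam f /\
       {within `[0, b], continuous (TRD b Psi (k%:R * alpha) lam f)}) :
  (forall k : nat, (k <= n)%N ->
     TRD_exists b Psi alpha lam (iter k (TRD b Psi alpha lam) f)) /\
  forall t : R, 0 <= t <= b ->
    exists c : R, [/\ 0 <= c <= t, (0 < t -> 0 < c < t) &
      f t =
      expR (- lam * (Psi t - Psi 0)) *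
      (\sum_(0 <= k < n.+1)
          (Psi t - Psi 0) `^ (k.+1%:R * alpha - 1) / Gamma (k.+1%:R * alpha)
          * RL_integral b Psi (1 - alpha)
              (fun s => expR (lam * (Psi s - Psi 0))
                        * iter k (TRD b Psi alpha lam) f s) 0
       + (Psi t - Psi 0) `^ (n.+1%:R * alpha)
         * mittag_leffler 1 (n.+1%:R * alpha + 1) (lam * (Psi t - Psi 0))
         * iter n.+1 (TRD b Psi alpha lam) f c)].
Proof.
have [itE fE exk] := TRD_iterate b_gt0 Psi_smooth Psi_mono dPsi_gt0 alpha01 f_TRD (leqnn n.+1).
split=> [k kn|t tb]; first exact: exk.
have [_ cg] := f_TRD n.+1 (leqnn _).
have {}fE : forall t, 0 <= t <= b -> f t = tempered_integral b Psi (n.+1%:R * alpha) lam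
    (TRD b Psi (n.+1%:R * alpha) lam f) t by case: fE.
have beta0 : 0 < n.+1%:R * alpha by case/andP: alpha01 => a0 _; rewrite mulr_gt0.
(* The initial values are integrals over [0, 0]. *)
have sum0 : \sum_(0 <= k < n.+1)
    (Psi t - Psi 0) `^ (k.+1%:R * alpha - 1) / Gamma (k.+1%:R * alpha)
    * RL_integral b Psi (1 - alpha)
        (fun s => expR (lam * (Psi s - Psi 0)) * iter k (TRD b Psi alpha lam) f s) 0 = 0.
  by apply: big1 => k _; rewrite /RL_integral tempered_integral0 mulr0.
rewrite sum0; case/andP: (tb); rewrite le_eqVlt => /predU1P[<- _|t0 tb'].
  (* At t = 0 both sides are 0: f is a tempered integral, and 0 to the positive power (n + 1) alpha
     is 0. *)
  exists 0; split; rewrite ?lexx ?ltxx//.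
  rewrite fE ?lexx ?(ltW b_gt0)// tempered_integral0 subrr powR0 ?gt_eqF//.
  by rewrite !mul0r add0r mulr0.
have [|c /andP[c0 ct] E] := tempered_integral_mean b_gt0 Psi_smooth Psi_mono dPsi_gt0 lam beta0 cg (t := t).
  by rewrite t0.
exists c; split => [|_|]; [by rewrite !ltW|by rewrite c0|].
have X0 : 0 <= Psi t - Psi 0.
  by rewrite subr_ge0 ltW// (Psi_lt Psi_smooth Psi_mono dPsi_gt0).
rewrite add0r (fE t tb) E (conv_int_cst1E lam beta0 X0) (itE c); first by rewrite -!mulrA.
by rewrite (ltW c0) (le_trans (ltW ct)).
Qed.
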